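(* Let $X$ be a real Banach space with dual $X^*$. The following two assertions are equivalent: (i) for all maximally monotone operators $A,B\colon X\rightrightarrows X^*$ with $\operatorname{dom}A\cap\operatorname{int}\operatorname{dom}B\neq\varnothing$, the operator $A+B$ is maximally monotone; (ii) for every maximally monotone operator $A\colon X\rightrightarrows X^*$ and every nonempty closed convex subset $C$ of $X$ with $\operatorname{dom}A\cap\operatorname{int}C\neq\varnothing$, the operator $A+N_C$ is maximally monotone.
   Context: $X$ is a real Banach space, $X^*$ its continuous dual, $\langle\cdot,\cdot\rangle$ the duality pairing. For a set-valued operator $A\colon X\rightrightarrows X^*$ (i.e. $Ax\subseteq X^*$ for every $x\in X$), $\operatorname{gra}A=\{(x,x^* )\in X\times X^* : x^*\in Ax\}$ and $\operatorname{dom}A=\{x\in X: Ax\neq\varnothing\}$. $A$ is monotone if $\langle x-y,x^*-y^*\rangle\ge 0$ for all $(x,x^* ),(y,y^* )\in\operatorname{gra}A$; it is maximally monotone if it is monotone and has no proper monotone extension (in the sense of graph inclusion). The sum is $(A+B)x=\{a^*+b^* : a^*\in Ax,\ b^*\in Bx\}$. For $C\subseteq X$, $\operatorname{int}C$ is the norm interior, and the normal cone operator is $N_C(x)=\{x^*\in X^*: \sup_{c\in C}\langle c-x,x^*\rangle\le 0\}$ if $x\in C$ and $N_C(x)=\varnothing$ if $x\notin C$. *)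

(* Defs.v *)
From HB Require Import structures.
From mathcomp Require Import all_boot all_order all_algebra.
From mathcomp Require Import all_classical all_reals all_analysis.

Set Implicit Arguments.
Unset Strict Implicit.
Unset Printing Implicit Defensive.

Import Order.TTheory GRing.Theory Num.Theory.
Import numFieldNormedType.Exports.

Local Open Scope classical_set_scope.
Local Open Scope ring_scope.

Section Dual.
Context (R : realType) (X : normedModType R).

Definition dual_pred : {pred X -> R^o} :=
  fun f => `[< linear f /\ continuous f >].

Lemma dual_predP (f : X -> R^o) :
  reflect (linear f /\ continuous f) (f \in dual_pred).
Proof. exact: asboolP. Qed.

Fact dual_submod_closed : submod_closed dual_pred.
Proof.
split.
  apply/dual_predP; split; last exact: cst_continuous.
  by move=> a x y; rewrite /GRing.zero /= scaler0 addr0.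
move=> a f g /dual_predP[lf cf] /dual_predP[lg cg]; apply/dual_predP; split.
  move=> b x y; rewrite !fctE lf lg !scalerDr !scalerA (mulrC a b).
  exact: addrACA.
move=> x; apply: (@continuousD _ _ _ (a *: f) g); last exact: cg.
exact: (@continuousZl_tmp R R^o X f a x (cf x)).
Qed.

HB.instance Definition _ :=
  GRing.isSubmodClosed.Build R (X -> R^o) dual_pred dual_submod_closed.

(* The continuous dual of [X], with pointwise operations.  The coercion to
   functions is the duality pairing: [xs x] is <x, xs>. *)
Record dual :=
  Dual { dual_fun :> X -> R^o; dual_funP : dual_fun \in dual_pred }.

HB.instance Definition _ := [isSub for dual_fun].
HB.instance Definition _ := [Choice of dual by <:].
HB.instance Definition _ := [SubChoice_isSubLmodule of dual by <:].

Lemma dualDE (f g : dual) (x : X) : (f + g) x = f x + g x.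
Proof. by []. Qed.

Lemma dualNE (f : dual) (x : X) : (- f) x = - f x.
Proof. by []. Qed.

Lemma dualZE (a : R) (f : dual) (x : X) : (a *: f) x = a * f x.
Proof. by []. Qed.

End Dual.

Section Operators.
Context (R : realType) (X : normedModType R).

Definition operator := X -> set (dual X).

Definition gra (A : operator) : set (X * dual X) := [set p | A p.1 p.2].

Definition dom (A : operator) : set X := [set x | A x !=set0].

Definition monotone_operator (A : operator) : Prop :=
  forall p q, gra A p -> gra A q -> 0 <= (p.2 - q.2) (p.1 - q.1).

Definition maximally_monotone (A : operator) : Prop :=
  monotone_operator A /\ ~ exists2 B, monotone_operator B & gra A `<` gra B.

Definition opadd (A B : operator) : operator :=
  fun x => [set a + b | a in A x & b in B x].

Definition normal_cone (C : set X) : operator :=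
  fun x => [set xs : dual X |
    C x /\ (ereal_sup [set (xs (c - x))%:E | c in C] <= 0)%E].

End Operators.

(* Main.v *)
Require Import Defs.
From HB Require Import structures.
From mathcomp Require Import all_boot all_order all_algebra ring lra.
From mathcomp Require Import all_classical all_reals all_analysis.

Set Implicit Arguments.
Unset Strict Implicit.
Unset Printing Implicit Defensive.

Import Order.TTheory GRing.Theory Num.Theory.
Import numFieldNormedType.Exports.
Local Open Scope classical_set_scope.
Local Open Scope ring_scope.

(** That (i) implies (ii) is the case [B = N_C]: when [C] is closed and convex
    with nonempty interior, [N_C] is maximally monotone with domain [C]
    ([normal_cone_maximal]).

    For the converse, translate so that [0] lies in the interior of [dom B] and
    [A 0], [B 0] contain [0].  Write [F_T(x, x')] for the Fitzpatrick function of
    [T], the supremum of [<x, a'> + <a, x'> - <a, a'>] over the graph of [T].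

    Duality reduces the theorem to an inequality.  Suppose that
    [F_(A+B)(x, x') >= <x, x'>] everywhere.  If [(z, z')] is monotonically
    related to [A + B] there is equality at [(z, z')], so the convex function
    [F_(A+B)] lies above the tangent of the pairing there.  Since
    [F_A(x, x') + F_B(x, y') >= F_(A+B)(x, x' + y')], this gives two convex
    functions of [x] with nonnegative sum, one built from [F_A] and one from [F_B]; the
    sandwich theorem puts an affine function between the first and the opposite of
    the second, and its slope [u'] is in [A z] with [z' - u'] in [B z]
    ([opadd_maximal]).

    The inequality says that [<z - x, z' - a' - b'>] is not bounded below by a
    positive number when [a'] is in [A x] and [b'] in [B x] ([gap_le0]).  Let [D]
    be a closed convex set with [dom B] in [D] and [int D] in [dom B]: the closure
    of the projection of the domain of [F_B] ([interior_fitz_dom]).  By (ii) the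
    operator [A + N_D] is maximally monotone, with domain in [D], and it may
    replace [A] because [B + N_D] is contained in [B].  Assertion (ii), applied to a thin tube around
    a segment issued from a point of [dom A], also gives this local form of
    maximality: for every [(x, x')] there is a graph point [(y, y')] of [A] with
    [y] in the tube and [<x - y, x' - y'> <= 0] ([tube_graph_point]).

    If [z] is in [int D] and adherent to [dom A], the tube is chosen close to [z],
    where [B] is bounded.  If [z] is not adherent to [dom A], the tube runs from
    [0] to [z] and [x'] is a large multiple of a norming functional, which
    produces [y] in [dom A] at a distance from [z] with [<z - y, y'>] as large as
    desired.  This suffices when [y] is in [dom B].  Otherwise [y] is in
    [D] but not in [dom B], so that [<x, b'>] tends to infinity as [x] tends to
    [y] along the graph of [B] ([dp_blowup]).  Pushing [y] a little towards [0]
    and [z] and taking a tube there gives points [x] of [dom A] in [int D] that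
    tend to [y] and for which [<z - x, x'>] stays bounded below; this is
    again a contradiction ([gap_blowup]).  The remaining points [z], on
    the boundary of [D], are limits of [l z] with [l < 1]. *)

(** * A linear form below a convex cone *)

Section HahnBanach.
Context (R : realType) (V : lmodType R).
Implicit Types (K S : set (V * R)).

Definition convex_cone K :=
  (forall x a y b, K (x, a) -> K (y, b) -> K (x + y, a + b)) /\
  (forall t x a, 0 < t -> K (x, a) -> K (t *: x, t * a)).

(** Zorn gives a maximal cone [K] containing [S] that meets the axis [{0} * R]
    only in nonnegative numbers; by maximality [K] is, up to its boundary, the
    epigraph of a function that is sublinear and odd, hence linear. *)
Lemma hahn_banach_cone S :
  convex_cone S -> (forall c, S (0, c) -> 0 <= c) ->
  (forall x, exists c, S (x, c)) ->
  exists2 f : V -> R^o, linear f & forall x c, S (x, c) -> f x <= c.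
Proof.
move=> [Sadd Sscale] Spos Sdom.
(* the empty chain has an empty union, whence the guard *)
pose good K := K !=set0 ->
  [/\ S `<=` K, convex_cone K & forall c, K (0, c) -> 0 <= c].
have [F Fgood Ftot|K [Kgood Kmax]] := @Zorn_bigcup _ good.
  move=> [p [K FK Kp]].
  have goodF L q : F L -> L q ->
    [/\ S `<=` L, convex_cone L & forall c, L (0, c) -> 0 <= c].
    by move=> FL Lq; apply: Fgood => //; exists q.
  split.
  - by move=> q Sq; exists K => //; have [+ _ _] := goodF _ _ FK Kp; apply.
  - split=> [x a y b [L1 F1 L1x] [L2 F2 L2y]|t x a t0 [L1 F1 L1x]]; last first.
      have [_ [_ h] _] := goodF _ _ F1 L1x.
      by exists L1 => //; apply: h.
    have [_ [h1 _] _] := goodF _ _ F1 L1x.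
    have [_ [h2 _] _] := goodF _ _ F2 L2y.
    have [L12|L21] := Ftot _ _ F1 F2.
      by exists L2 => //; apply: h2 => //; apply: L12.
    by exists L1 => //; apply: h1 => //; apply: L21.
  - by move=> c [L FL Lc]; have [_ _] := goodF _ _ FL Lc; apply.
have [c0 Sc0] := Sdom 0.
have KN0 : K !=set0.
  apply/set0P/negP => /eqP K0; apply: (Kmax S).
    by rewrite K0; split=> [|/(_ _ Sc0)//]; exact: sub0set.
  by move=> _; split.
have [SK [Kadd Kscale] Kpos] := Kgood KN0.
(* maximality: adding a point outside K would create a negative number on the
   axis, and K contains the point responsible for it *)
have Kout x c : ~ K (x, c) -> exists2 d, K (- x, d) & d < - c.
  move=> nK; apply: contrapT => noD.
  (* the cone generated by K and (x, c) *)
  pose L : set (V * R) := [set p | K p \/ exists t, 0 < t /\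
     (p = (t *: x, t * c) \/ exists q, K q /\ p = q + (t *: x, t * c))].
  apply: (Kmax L).
    split; first by left.
    move=> LK; apply: nK; apply: LK; right; exists 1; split; first exact: ltr01.
    by left; rewrite scale1r mul1r.
  have addE t1 t2 : (t1 *: x, t1 * c) + (t2 *: x, t2 * c) =
      ((t1 + t2) *: x, (t1 + t2) * c) :> V * R.
    by congr pair => /=; rewrite ?scalerDl ?mulrDl.
  have KaddP p q : K p -> K q -> K (p + q).
    by case: p q => [p1 p2] [q1 q2]; apply: Kadd.
  move=> _; split.
  - by move=> q /SK; left.
  - split.
      move=> y1 a1 y2 a2.
      change (L (y1, a1) -> L (y2, a2) -> L ((y1, a1) + (y2, a2))).
      move: (y1, a1) (y2, a2) => p q.
      move=> [Kp|[t [t0 Hp]]] [Kq|[s [s0 Hq]]].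
      + by left; apply: KaddP.
      + right; exists s; split=> //; right; case: Hq => [->|[q' [Kq' ->]]].
          by exists p.
        by exists (p + q'); split; [apply: KaddP|rewrite addrA].
      + right; exists t; split=> //; right; case: Hp => [->|[q' [Kq' ->]]].
          by exists q; split=> //; rewrite addrC.
        by exists (q' + q); split; [apply: KaddP|rewrite addrAC].
      + right; exists (t + s); split; first exact: addr_gt0.
        case: Hp => [->|[p' [Kp' ->]]]; case: Hq => [->|[q' [Kq' ->]]].
        * by left; rewrite addE.
        * by right; exists q'; split=> //; rewrite addrCA addE.
        * by right; exists p'; split=> //; rewrite -addrA addE.
        * right; exists (p' + q'); split; first exact: KaddP.
          by rewrite addrACA addE.
    move=> t y a t0 [Ky|[s [s0 [[-> ->]|[[q1 q2] [Kq [-> ->]]]]]]].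
    + by left; apply: Kscale.
    + right; exists (t * s); split; first exact: mulr_gt0.
      by left; rewrite scalerA mulrA.
    + right; exists (t * s); split; first exact: mulr_gt0.
      right; exists (t *: q1, t * q2); split; first exact: Kscale.
      by congr pair => /=; rewrite ?scalerDr ?mulrDr ?scalerA ?mulrA.
  - move=> d [/Kpos //|[t [t0 [[] /esym/eqP + ->|[[q1 q2] [Kq []]]]]]].
      rewrite scaler_eq0 gt_eqF //= => /eqP x0.
      rewrite leNgt; apply/negP => tc0; apply: noD.
      have c_lt0 : c < 0 by rewrite -(pmulr_rlt0 _ t0).
      have c0_ge0 := Kpos _ (SK _ Sc0).
      exists (- c / (c0 + 1) * c0).
        rewrite x0 oppr0 -[X in K (X, _)](scaler0 _ (- c / (c0 + 1))).
        by apply: Kscale; [apply: divr_gt0; lra|exact: SK].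
      rewrite -mulrA gtr_pMr; last lra.
      by rewrite mulrC ltr_pdivrMr; lra.
    move=> q1E ->; rewrite leNgt; apply/negP => tc0; apply: noD.
    exists (t^-1 * q2); last by rewrite -ltr_pdivlMl ?invr_gt0 // invrK; lra.
    have -> : - x = t^-1 *: q1.
      have -> : q1 = - (t *: x) by apply/eqP; rewrite -addr_eq0 -q1E.
      by rewrite -scalerN scalerA mulVf ?gt_eqF // scale1r.
    by apply: Kscale => //; rewrite invr_gt0.
pose f (x : V) : R^o := inf [set c | K (x, c)].
have fin x : has_inf [set c | K (x, c)].
  have [c Sc] := Sdom x; split; first by exists c; apply: SK.
  have [d Sd] := Sdom (- x); exists (- d) => a Ka.
  have := Kpos (a + d); rewrite -[X in K (X, _)](subrr x).
  by move=> /(_ (Kadd _ _ _ _ Ka (SK _ Sd))); rewrite -lerBlDr sub0r.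
have f_le x c : K (x, c) -> f x <= c.
  by move=> Kc; apply: ge_inf => //; have [] := fin x.
have f_lt x c : f x < c -> K (x, c).
  move=> fc; apply: contrapT => /Kout[d Kd dc].
  suff : - d <= f x by lra.
  apply: lb_le_inf; first by have [] := fin x.
  move=> a Ka; have := Kpos (a + d); rewrite -[X in K (X, _)](subrr x).
  by move=> /(_ (Kadd _ _ _ _ Ka Kd)); rewrite -lerBlDr sub0r.
have f_sub x y : f (x + y) <= f x + f y.
  rewrite leNgt; apply/negP => h.
  pose e := (f (x + y) - (f x + f y)) / 3 : R.
  have e0 : 0 < e by rewrite divr_gt0 // subr_gt0.
  have eE : f (x + y) = f x + f y + 3 * e :> R by rewrite /e; field.
  have Kx : K (x, f x + e) by apply: f_lt; lra.
  have Ky : K (y, f y + e) by apply: f_lt; lra.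
  by have := f_le _ _ (Kadd _ _ _ _ Kx Ky); lra.
have f_ge0 : 0 <= f 0.
  by apply: lb_le_inf; [have [] := fin 0|move=> c /Kpos].
have f_odd x : f (- x) = - f x.
  apply/eqP; rewrite eq_le; apply/andP; split; last first.
    by have := f_sub x (- x); rewrite subrr; lra.
  rewrite leNgt; apply/negP => h.
  have /Kout[d /f_le] : ~ K (x, - f (- x)) by move=> /f_le; lra.
  by lra.
have f_add x y : f (x + y) = f x + f y.
  apply/eqP; rewrite eq_le f_sub /=.
  by have := f_sub (x + y) (- y); rewrite addrK f_odd; lra.
have f_pos t x : 0 < t -> f (t *: x) <= t * f x.
  move=> t0; rewrite leNgt; apply/negP => h.
  have Kx : K (x, t^-1 * f (t *: x)).
    by apply: f_lt; rewrite mulrC ltr_pdivlMr // mulrC.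
  pose e := (f (t *: x) - t * f x) / 2 : R.
  have e0 : 0 < e by rewrite divr_gt0 // subr_gt0.
  have {}Kx : K (x, f x + t^-1 * e).
    by apply: f_lt; rewrite ltrDl mulr_gt0 ?invr_gt0.
  have := f_le _ _ (Kscale _ _ _ t0 Kx).
  rewrite mulrDr mulrA divff ?gt_eqF // mul1r.
  have eE : f (t *: x) = t * f x + 2 * e :> R by rewrite /e; field.
  by lra.
have f_scale0 t x : 0 < t -> f (t *: x) = t * f x.
  move=> t0; apply/eqP; rewrite eq_le f_pos //=.
  have ti0 : 0 < t^-1 by rewrite invr_gt0.
  have := f_pos t^-1 (t *: x) ti0; rewrite scalerA mulVf ?gt_eqF // scale1r.
  by rewrite -(ler_pM2l t0) mulrA divff ?gt_eqF // mul1r.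
have f_scale t x : f (t *: x) = t * f x.
  have [t0|t0|<-] := ltgtP 0 t; first exact: f_scale0.
    rewrite -[t]opprK scaleNr f_odd f_scale0 ?oppr_gt0 //; lra.
  by rewrite scale0r mul0r; have := f_odd 0; rewrite oppr0; lra.
exists f; last by move=> x c /SK /f_le.
by move=> t x y; rewrite f_add f_scale.
Qed.

End HahnBanach.

(** * Duality pairing, dual norm, interior and closure *)

Section Pairing.
Context (R : realType) (X : normedModType R).
Implicit Types (x y : X) (f g : dual X).

(** The duality pairing, with values in [R] itself rather than in the module
    [R^o], so that arithmetic decision procedures see real numbers. *)
Definition dp x f : R := f x.

Lemma dual_linear f : linear f.
Proof. by have /dual_predP[] := dual_funP f. Qed.

Lemma dpDl x y f : dp (x + y) f = dp x f + dp y f.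
Proof. by rewrite /dp -[x]scale1r dual_linear !scale1r. Qed.

Lemma dp0l f : dp 0 f = 0.
Proof. by apply: (addrI (dp 0 f)); rewrite -dpDl !addr0. Qed.

Lemma dpZl a x f : dp (a *: x) f = a * dp x f.
Proof.
by rewrite -[a *: x]addr0 /dp dual_linear -/(dp 0 f) dp0l addr0.
Qed.

Lemma dpNl x f : dp (- x) f = - dp x f.
Proof. by rewrite -scaleN1r dpZl mulN1r. Qed.

Lemma dpDr x f g : dp x (f + g) = dp x f + dp x g.
Proof. by []. Qed.

Lemma dpNr x f : dp x (- f) = - dp x f.
Proof. by []. Qed.

Lemma dpZr a x f : dp x (a *: f) = a * dp x f.
Proof. by []. Qed.

Lemma dp0r x : dp x 0 = 0.
Proof. by []. Qed.

Definition dpE := (dpDl, dpNl, dpZl, dp0l, dpDr, dpNr, dpZr, dp0r).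

(** [M] bounds the dual norm of [f]. *)
Definition dual_le f M := forall x, dp x f <= M * `|x|.

Lemma dual_leN f M : dual_le f M -> forall x, - (M * `|x|) <= dp x f.
Proof. by move=> fM x; have := fM (- x); rewrite dpNl normrN; lra. Qed.

Lemma dual_bounded f : exists2 M : R, 0 < M & dual_le f M.
Proof.
have /dual_predP[lf cf] := dual_funP f.
pose F : {linear X -> R^o} :=
  HB.pack (dual_fun f) (GRing.isLinear.Build _ _ _ _ _ lf).
have : bounded_near F (nbhs (0 : X)) by apply: continuous_linear_bounded; exact: cf.
move=> /linear_boundedP/pinfty_ex_gt0[M M0 FM].
by exists M => // x; apply: le_trans (FM x); exact: ler_norm.
Qed.

Lemma dual_of_bound (h : X -> R^o) M :
  linear h -> (forall x, h x <= M * `|x|) -> exists f, forall x, dp x f = h x.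
Proof.
move=> lh hM.
pose F : {linear X -> R^o} := HB.pack h (GRing.isLinear.Build _ _ _ _ _ lh).
have FM x : `|F x| <= M * `|x|.
  rewrite ler_norml hM andbT lerNl.
  by have := hM (- x); rewrite normrN -[h (- x)]/(F (- x)) linearN.
have cF : continuous F.
  apply: bounded_linear_continuous; apply/linear_boundedP.
  near=> r => x; apply: (le_trans (FM x)).
  by apply: ler_wpM2r => //; near: r; exact: nbhs_pinfty_ge.
have hP : (h : X -> R^o) \in dual_pred (X := X) by apply/dual_predP.
by exists (Dual hP).
Unshelve. all: by end_near. Qed.

Lemma norm_scale_ge0 (a : R) x : 0 <= a -> `|a *: x| = a * `|x|.
Proof. by move=> a0; rewrite normrZ ger0_norm. Qed.

Lemma interior_ballP (S : set X) x :
  interior S x <-> exists2 r : R, 0 < r & forall y, `|y - x| < r -> S y.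
Proof.
split=> [/nbhs_ballP[r /= r0 rS]|[r r0 rS]].
  exists r => // y yr; apply: rS; rewrite -ball_normE /ball_ /=.
  by rewrite distrC.
apply/nbhs_ballP; exists r => // y; rewrite -ball_normE /ball_ /= => xy.
by apply: rS; rewrite distrC.
Qed.

Lemma closure_ballP (S : set X) x :
  closure S x <-> forall r : R, 0 < r -> exists2 y, S y & `|y - x| < r.
Proof.
split=> [cSx r r0|Sx B /nbhs_ballP[r /= r0 rB]].
  have [|y [Sy]] := cSx (ball x r); first exact: nbhsx_ballx.
  by rewrite -ball_normE /ball_ /= distrC => xy; exists y.
have [y Sy yx] := Sx r r0; exists y; split=> //; apply: rB.
by rewrite -ball_normE /ball_ /= distrC.
Qed.

End Pairing.

Arguments dp : simpl never.

(** * The sandwich theorem *)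

Lemma scale_convex_comb (R : pzRingType) (V : lmodType R) (t t' s : R)
  (x y x' y' : V) : (t + t') * s = t -> (t + t') * (1 - s) = t' ->
  t *: (x - y) + t' *: (x' - y') =
  (t + t') *: (s *: x + (1 - s) *: x' - (s *: y + (1 - s) *: y')).
Proof.
move=> E1 E2.
rewrite opprD !scalerDr !scalerN !scalerA E1 E2.
by rewrite [RHS]addrACA.
Qed.

Section Sandwich.
Context (R : realType) (X : normedModType R).

Definition convexS (C : set X) := forall x y t, 0 <= t <= 1 ->
  C x -> C y -> C (t *: x + (1 - t) *: y).

Definition convexR (P : X -> R -> Prop) := forall x a y b t, 0 <= t <= 1 ->
  P x a -> P y b -> P (t *: x + (1 - t) *: y) (t * a + (1 - t) * b).

(** [P] and [Q] stand for the epigraphs of two convex functions [p], [q] with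
    [p + q >= 0].  The cone generated by the differences [(x - y, a + b)] meets
    the vertical axis in nonnegative numbers only, and the ball contained in [Q]
    makes it absorbing, so that a linear form lies below it; the same ball makes
    this form continuous. *)
Lemma sandwich (P Q : X -> R -> Prop) x0 (a0 r M : R) :
  convexR P -> convexR Q ->
  (forall x a b, P x a -> Q x b -> 0 <= a + b) ->
  0 < r -> P x0 a0 -> (forall y, `|y - x0| < r -> Q y M) ->
  exists (u : dual X) (k : R), (forall x a, P x a -> dp x u + k <= a) /\
    (forall x b, Q x b -> - dp x u - k <= b).
Proof.
move=> cP cQ PQ r0 Px0 Qx0.
pose S : set (X * R) := [set p | exists (t : R) x a y b, [/\ 0 < t, P x a, Q y b &
  p = (t *: (x - y), t * (a + b))]].
have S_cone : convex_cone S.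
  split; last first.
    move=> s ? ? s0 [t [x [a [y [b [t0 Pxa Qyb [-> ->]]]]]]].
    exists (s * t), x, a, y, b; split=> //; first exact: mulr_gt0.
    by rewrite scalerA mulrA.
  move=> ? ? ? ? [t [x [a [y [b [t0 Pxa Qyb [-> ->]]]]]]].
  move=> [t' [x' [a' [y' [b' [t'0 Pxa' Qyb' [-> ->]]]]]]].
  have T0 : 0 < t + t' by exact: addr_gt0.
  have s01 : 0 <= t / (t + t') <= 1.
    by apply/andP; split; [apply: divr_ge0; lra|rewrite ler_pdivrMr // mul1r; lra].
  move: s01; set s := t / (t + t') => s01.
  exists (t + t'), (s *: x + (1 - s) *: x'), (s * a + (1 - s) * a').
  exists (s *: y + (1 - s) *: y'), (s * b + (1 - s) * b').
  split; [by []|exact: cP|exact: cQ|].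
  have E1 : (t + t') * s = t by rewrite /s; field; rewrite gt_eqF.
  have E2 : (t + t') * (1 - s) = t' by rewrite /s; field; rewrite gt_eqF.
  congr pair => /=.
    exact: scale_convex_comb.
  by transitivity ((t + t') * s * (a + b) + (t + t') * (1 - s) * (a' + b'));
    [rewrite E1 E2|ring].
have S_pos c : S (0, c) -> 0 <= c.
  move=> [t [x [a [y [b [t0 Pxa Qyb [/esym/eqP + ->]]]]]]].
  rewrite scaler_eq0 gt_eqF //= subr_eq0 => /eqP xy.
  by rewrite pmulr_rge0 //; apply: PQ Pxa _; rewrite xy.
pose k : X -> R := fun x => 2 * (`|x| + 1) / r.
have k0 x : 0 < k x.
  by rewrite divr_gt0 // mulr_gt0 // ltr_wpDl.
have S_dom x : S (x, k x * (a0 + M)).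
  have kx := k0 x.
  exists (k x), x0, a0, (x0 - (k x)^-1 *: x), M; split=> //.
    apply: Qx0; rewrite addrAC subrr add0r normrN normrZ gtr0_norm ?invr_gt0 //.
    rewrite mulrC ltr_pdivrMr // /k mulrCA divff ?gt_eqF // mulr1.
    by have := normr_ge0 x; lra.
  by rewrite opprB addrCA subrr addr0 scalerA divff ?gt_eqF // scale1r.
have [|h lh hS] := hahn_banach_cone S_cone S_pos.
  by move=> x; eexists; exact: S_dom.
pose H : {linear X -> R^o} := HB.pack h (GRing.isLinear.Build _ _ _ _ _ lh).
have hsmall x : `|x| < r -> h x <= a0 + M.
  move=> xr; have := hS x (1 * (a0 + M)); rewrite mul1r; apply.
  exists 1, x0, a0, (x0 - x), M; split=> //.
    by apply: Qx0; rewrite addrAC subrr add0r normrN.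
  by rewrite mul1r scale1r opprB addrCA subrr addr0.
have aM0 : 0 <= a0 + M by apply: (PQ x0) => //; apply: Qx0; rewrite subrr normr0.
have [|u uE] := @dual_of_bound _ _ h (2 * (a0 + M) / r) lh.
  move=> x; have [->|x0'] := eqVneq x 0.
    by rewrite -[h 0]/(H 0) linear0 normr0 mulr0.
  have nx : 0 < `|x| by rewrite normr_gt0.
  have s0 : 0 < r / (2 * `|x|) by rewrite divr_gt0 // mulr_gt0.
  have : h ((r / (2 * `|x|)) *: x) <= a0 + M.
    apply: hsmall; rewrite normrZ gtr0_norm //.
    have -> : r / (2 * `|x|) * `|x| = r / 2 by field; rewrite gt_eqF.
    lra.
  rewrite -[h _]/(H _) linearZ /= -[_ *: _]/(_ * _) mulrC -ler_pdivlMr //.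
  move=> /le_trans; apply; rewrite le_eqVlt; apply/orP; left; apply/eqP.
  by field; rewrite !gt_eqF.
have uPQ x a y b : P x a -> Q y b -> dp x u - a <= dp y u + b.
  move=> Px Qy; have /hS : S (x - y, a + b).
    by exists 1, x, a, y, b; split; rewrite ?ltr01 // scale1r mul1r.
  by rewrite -uE !dpE; lra.
pose L : set R := [set c | exists x a, P x a /\ c = dp x u - a].
have supL : has_sup L.
  split; first by exists (dp x0 u - a0), x0, a0.
  exists (dp x0 u + M) => _ [x [a [Px ->]]].
  by apply: uPQ Px _; apply: Qx0; rewrite subrr normr0.
exists u, (- sup L); split.
  move=> x a Px; have : dp x u - a <= sup L; last lra.
  by apply: ub_le_sup; [case: supL|exists x, a].
move=> y b Qy; have : sup L <= dp y u + b; last lra.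
by apply: ge_sup; [case: supL|move=> _ [x [a [Px ->]]]; exact: uPQ].
Qed.

End Sandwich.

(** * Norming functionals *)

Section Norming.
Context (R : realType) (X : normedModType R).
Implicit Types (x y v w : X) (f g : dual X).

(** Separate [t v |-> - t |v|], on the line of [v], from the norm. *)
Lemma norming_functional v : exists2 f, dual_le f 1 & dp v f = `|v|.
Proof.
pose P x (a : R) := exists t : R, x = t *: v /\ a = - t * `|v|.
pose Q x (b : R) := `|x| <= b.
have [||||||u [k [uP uQ]]] := @sandwich _ _ P Q 0 0 1 1.
- rewrite /convexR /P => ? ? ? ? s _ [t [-> ->]] [t' [-> ->]].
  exists (s * t + (1 - s) * t'); split; last ring.
  by rewrite !scalerA -scalerDl.
- move=> x a y b s /andP[s0 s1]; rewrite /Q => xa yb.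
  apply: (le_trans (ler_normD _ _)); rewrite !normrZ !ger0_norm //; last lra.
  by apply: lerD; apply: ler_wpM2l => //; lra.
- move=> ? ? b [t [-> ->]]; rewrite /Q normrZ.
  have := ler_norm t; have := normr_ge0 v; nra.
- exact: ltr01.
- by exists 0; rewrite scale0r oppr0 mul0r.
- by move=> y; rewrite subr0 /Q => /ltW.
have k0 : k = 0.
  have := uP 0 0; have := uQ 0 0; rewrite /Q normr0 !dpE.
  move=> /(_ (lexx _)) h1 h2; have : 0 + k <= 0; last by lra.
  by apply: h2; exists 0; rewrite scale0r oppr0 mul0r.
exists (- u) => [x|]; rewrite dpE.
  by have := uQ x `|x| (lexx _); rewrite k0; lra.
have h1 : dp v u + k <= - `|v|.
  by apply: uP; exists 1; rewrite scale1r mulN1r.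
have h2 : dp (- v) u + k <= `|v|.
  by apply: uP; exists (-1); rewrite scaleN1r opprK mul1r.
by move: h1 h2; rewrite k0 !dpE; lra.
Qed.

(** Functionals separate points: this turns identities between vectors into
    identities between real numbers, provable by [ring] or [field]. *)
Lemma dp_eq v w : (forall f, dp v f = dp w f) -> v = w.
Proof.
move=> vw; have [f _ fE] := norming_functional (v - w).
by apply/eqP; rewrite -subr_eq0 -normr_eq0 -fE !dpE vw subrr.
Qed.

Lemma norm_le_dp v c : (forall f, dual_le f 1 -> dp v f <= c) -> `|v| <= c.
Proof. by move=> vc; have [f f1 <-] := norming_functional v; exact: vc. Qed.

End Norming.

(** * Maximal monotonicity and translations *)

Section Monotone.
Context (R : realType) (X : normedModType R).
Implicit Types (A B : operator X) (x y : X) (xs ys : dual X).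

Definition related A x xs :=
  forall y ys, A y ys -> 0 <= dp (x - y) (xs - ys).

Lemma maximally_monotoneP A : maximally_monotone A <->
  (forall x xs, A x xs -> related A x xs) /\
  (forall x xs, related A x xs -> A x xs).
Proof.
split=> [[mA maxA]|[mA maxA]].
  split=> [x xs Ax y ys Ay|x xs rel]; first exact: (mA (x, xs) (y, ys)).
  apply: contrapT => nA; apply: maxA.
  exists (fun y => [set ys | A y ys \/ (y, ys) = (x, xs)]).
    move=> [p1 p2] [q1 q2] [Ap|[-> ->]] [Aq|[-> ->]] /=.
    - exact: (mA (p1, p2) (q1, q2)).
    - change (0 <= dp (p1 - x) (p2 - xs)).
      by have := rel _ _ Ap; rewrite !dpE; lra.
    - exact: rel.
    - by change (0 <= dp (x - x) (xs - xs)); rewrite subrr dp0l.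
  split=> [p Ap|]; first by left.
  by move=> /(_ (x, xs)) h; apply: nA; apply: h; right.
split=> [[p1 p2] [q1 q2] Ap Aq|[B mB [AB nBA]]]; first exact: mA.
apply: nBA => -[x xs] Bx; apply: maxA => y ys Ay.
by apply: (mB (x, xs) (y, ys)) => //; apply: AB.
Qed.

Definition translate A a (a' : dual X) : operator X :=
  fun x => [set xs | A (x + a) (xs + a')].

Lemma translate_maximally_monotone A a a' :
  maximally_monotone (translate A a a') <-> maximally_monotone A.
Proof.
have addBr (V : zmodType) (x y c : V) : x + c - (y + c) = x - y.
  by rewrite opprD addrACA subrr addr0.
rewrite !maximally_monotoneP; split=> -[mA maxA]; split.
- move=> x xs Ax y ys Ay.
  have := mA (x - a) (xs - a'); rewrite /translate /= !subrK => /(_ Ax).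
  by move=> /(_ (y - a) (ys - a')); rewrite /= !subrK !addBr; apply.
- move=> x xs rel; have := maxA (x - a) (xs - a').
  rewrite /translate /= !subrK; apply=> y ys /= /rel.
  by rewrite !dpE; lra.
- by move=> x xs Ax y ys Ay; have := mA _ _ Ax _ _ Ay; rewrite !addBr.
- move=> x xs rel; apply: maxA => y ys Ay.
  have := rel (y - a) (ys - a'); rewrite /translate /= !subrK => /(_ Ay).
  by rewrite !dpE; lra.
Qed.

End Monotone.

(** * Local boundedness in the interior of the domain *)

Section LocalBoundedness.
Context (R : realType) (X : completeNormedModType R).
Implicit Types (A : operator X).

(** Subtract an element of [A w] so that [0] is in [A w].  The functionals
    [ys / (1 + <y - w, ys>)] are pointwise bounded when [(y, ys)] runs over the
    graph near [w]: test monotonicity at [w + s x].  By Banach-Steinhaus they are uniformly bounded, and the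
    denominator is absorbed when [y] is close enough to [w]. *)
Lemma locally_bounded A w :
  (forall x xs, A x xs -> related A x xs) -> interior (dom A) w ->
  exists r M : R, [/\ 0 < r, 0 < M &
    forall y ys, `|y - w| < r -> A y ys -> dual_le ys M].
Proof.
move=> mA wA; have [b0 Ab0] : dom A w by exact: interior_subset wA.
have [r0 r00 r0A] := (interior_ballP _ _).1 wA.
pose F : set (X -> R^o) := [set g : X -> R^o |
  exists y ys, [/\ `|y - w| <= 1, A y ys &
    g = dual_fun ((1 + dp (y - w) (ys - b0))^-1 *: (ys - b0))]].
have F_N y ys : A y ys -> 0 <= dp (y - w) (ys - b0).
  by move=> Ay; exact: mA.
have F_lin g : F g -> bounded_fun_norm g /\ linear g.
  move=> [y [ys [_ _ ->]]]; split; last exact: dual_linear.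
  set f := (X in dual_fun X); have [K K0 fK] := dual_bounded f => r.
  exists (K * r) => x xr; rewrite -[dual_fun f x]/(dp x f).
  have fx := fK x; have fNx := dual_leN fK x.
  have Kxr : K * `|x| <= K * r by rewrite ler_pM2l.
  by rewrite ler_norml; apply/andP; split; lra.
(* s x is small enough for w + s x to be in the domain *)
have F_up x : exists K : R, forall g, F g -> g x <= K.
  pose s := r0 / 2 / (`|x| + 1).
  have x1 : 0 < `|x| + 1 by rewrite ltr_wpDl.
  have s0 : 0 < s by rewrite !divr_gt0.
  have sE : s * (`|x| + 1) = r0 / 2 by rewrite /s; field; rewrite gt_eqF.
  have sx : `|w + s *: x - w| < r0.
    by rewrite addrAC subrr add0r normrZ gtr0_norm //; lra.
  have [c Ac] := r0A _ sx; have [K K0 cK] := dual_bounded (c - b0).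
  exists ((1 + (s * (K * `|x|) + K)) / s) => _ [y [ys [y1 Ay ->]]].
  rewrite -[dual_fun _ x]/(dp x _) dpZr.
  have N0 := F_N _ _ Ay; set N := dp (y - w) (ys - b0) in N0 *.
  suff h : s * dp x (ys - b0) <= (1 + (s * (K * `|x|) + K)) * (1 + N).
    rewrite [leLHS]mulrC ler_pdivrMr; last lra.
    by rewrite mulrAC ler_pdivlMr // mulrC.
  have h1 := mA _ _ Ac _ _ Ay.
  have h2 : s * dp x (c - b0) <= s * (K * `|x|) by rewrite ler_pM2l.
  have h3 := cK (w - y); have h4 : K * `|w - y| <= K by rewrite ger_pMr // distrC.
  have h5 : 0 <= (s * (K * `|x|) + K) * N.
    by rewrite mulr_ge0 // addr_ge0 ?mulr_ge0 // ltW.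
  have NE : N = dp y ys - dp w ys - dp y b0 + dp w b0 by rewrite /N !dpE; ring.
  move: h1 h2 h3 h5; rewrite !dpE.
  lra.
have F_pt : pointwise_bounded F.
  move=> x; have [K1 FK1] := F_up x; have [K2 FK2] := F_up (- x).
  exists (Num.max K1 K2) => g Fg.
  have := FK1 _ Fg; have := FK2 _ Fg; move: Fg => [y [ys [_ _ ->]]].
  rewrite -!/(dp _ _) => h2 h1; rewrite ler_norml le_max h1 /= andbT lerNl.
  by move: h2; rewrite dpNl le_max => ->; rewrite orbT.
have [M FM] := Banach_Steinhauss F_lin F_pt 1.
have [K K0 bK] := dual_bounded b0.
pose m := Num.max M 1; have m0 : 0 < m by rewrite lt_max ltr01 orbT.
exists (2 * m)^-1, (2 * m + K); split; [by rewrite invr_gt0; lra|lra|].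
move=> y ys yw Ay x.
have N0 := F_N _ _ Ay; set N := dp (y - w) (ys - b0) in N0.
have N1 : 0 < 1 + N by lra.
have mE : 2 * m * (2 * m)^-1 = 1 by rewrite divff // gt_eqF //; lra.
have ym : 2 * m * `|y - w| <= 1.
  have m2 : 0 < 2 * m by lra.
  by rewrite mulrC -ler_pdivlMr // mul1r ltW.
have m1 : 1 <= m by rewrite le_max lexx orbT.
have y1 : `|y - w| <= 1 by have := normr_ge0 (y - w); nra.
have f_unit v : dp v (ys - b0) <= m * (1 + N) * `|v|.
  have [->|v0] := eqVneq v 0; first by rewrite normr0 dp0l mulr0.
  have nv : 0 < `|v| by rewrite normr_gt0.
  have := FM _ (ex_intro _ y (ex_intro _ ys (And3 y1 Ay erefl))) (`|v|^-1 *: v).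
  rewrite normrZ gtr0_norm ?invr_gt0 // mulVf ?gt_eqF // => /(_ (lexx _)).
  rewrite -!/(dp _ _) => /(le_trans (ler_norm _)); rewrite dpZl dpZr -/N.
  rewrite mulrC ler_pdivrMr // mulrC ler_pdivrMr // => h.
  apply: (le_trans h); rewrite mulrAC ler_pM2r // ler_pM2r //.
  by rewrite le_max lexx.
have N2 : N <= 1.
  have := f_unit (y - w); rewrite -/N.
  have : m * (1 + N) * `|y - w| <= (1 + N) / 2.
    by rewrite mulrAC; nra.
  lra.
have h : m * (1 + N) * `|x| <= 2 * m * `|x|.
  by apply: ler_wpM2r => //; nra.
by have := f_unit x; have := bK x; rewrite !dpE mulrDl; lra.
Qed.

End LocalBoundedness.

(** * The Fitzpatrick function *)

Section Fitzpatrick.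
Context (R : realType) (X : normedModType R).
Implicit Types (A B : operator X) (x y z : X) (xs ys zs : dual X).

(** [c] is an upper bound of the Fitzpatrick function of [A] at [(x, xs)]. *)
Definition fitz A x xs (c : R) :=
  forall a a', A a a' -> dp x a' + dp a xs - dp a a' <= c.

(** The projection on [X] of the domain of the Fitzpatrick function: a convex
    substitute for [dom A]. *)
Definition fitz_dom A : set X := [set x | exists xs c, fitz A x xs c].

(** The strict part of the epigraph of [x |-> inf_xs (F_A(x, xs) - <y, xs>)],
    together with points where the infimum is attained.  An affine minorant of
    this convex function that is nonnegative at [y] is an element of [A y]
    ([fitz_slice_support]). *)
Definition fitz_slice A y x (c : R) :=
  exists xs d, fitz A x xs d /\ d - dp y xs <= c.

Lemma fitz_convex A x xs c y ys d t : 0 <= t <= 1 ->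
  fitz A x xs c -> fitz A y ys d ->
  fitz A (t *: x + (1 - t) *: y) (t *: xs + (1 - t) *: ys) (t * c + (1 - t) * d).
Proof.
move=> /andP[t0 t1] fx fy a a' Aa; have := fx _ _ Aa; have := fy _ _ Aa.
by rewrite !dpE; nra.
Qed.

Lemma fitz_gra A x xs : (forall x xs, A x xs -> related A x xs) ->
  A x xs -> fitz A x xs (dp x xs).
Proof. by move=> mA Ax a a' Aa; have := mA _ _ Ax _ _ Aa; rewrite !dpE; lra. Qed.

(** A bound below the pairing would make [(x, xs)] monotonically related to
    [A], hence a point of its graph, where the bound cannot be smaller than the
    pairing. *)
Lemma fitz_ge A x xs c : maximally_monotone A -> fitz A x xs c -> dp x xs <= c.
Proof.
move=> /maximally_monotoneP[mA maxA] fx; rewrite leNgt; apply/negP => cx.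
have /fx : A x xs by apply: maxA => y ys /fx; rewrite !dpE; lra.
by lra.
Qed.

Lemma fitz_slice_convex A y : convexR (fitz_slice A y).
Proof.
move=> x a x' b t t01 [xs [d [fx dx]]] [xs' [d' [fx' dx']]].
exists (t *: xs + (1 - t) *: xs'), (t * d + (1 - t) * d').
split; first exact: fitz_convex.
by move: t01 => /andP[t0 t1]; rewrite !dpE; nra.
Qed.

Lemma fitz_slice_ge A y c : maximally_monotone A -> fitz_slice A y y c -> 0 <= c.
Proof. by move=> maxA [xs [d [/(fitz_ge maxA)]]]; lra. Qed.

Lemma fitz_slice_gra A y x xs : maximally_monotone A -> A x xs ->
  fitz_slice A y x (dp (x - y) xs).
Proof.
move=> /maximally_monotoneP[mA _] Ax; exists xs, (dp x xs).
by split; [exact: fitz_gra|rewrite !dpE; lra].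
Qed.

Lemma fitz_slice_support A y u k : maximally_monotone A ->
  (forall x c, fitz_slice A y x c -> dp x u + k <= c) -> 0 <= dp y u + k ->
  A y u.
Proof.
move=> maxA Au yu; have [_] := (maximally_monotoneP A).1 maxA; apply=> x xs Ax.
by have := Au _ _ (fitz_slice_gra y maxA Ax); rewrite !dpE; lra.
Qed.

Lemma dom_fitz_dom A : maximally_monotone A -> dom A `<=` fitz_dom A.
Proof.
move=> /maximally_monotoneP[mA _] x [xs Ax].
by exists xs, (dp x xs); exact: fitz_gra.
Qed.

Lemma fitz_dom_convex A : convexS (fitz_dom A).
Proof.
move=> x y t t01 [xs [c fx]] [ys [d fy]].
exists (t *: xs + (1 - t) *: ys), (t * c + (1 - t) * d); exact: fitz_convex.
Qed.

(** A closedness property of the graph, usually drawn from weak-star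
    compactness.  Here the bounded graph points show that
    [F_A(x, xs) - <y, xs> + M |x - y| >= 0], and separating the two parts of this
    sum produces an element of [A y]. *)
Lemma dom_of_bounded A y M : maximally_monotone A -> 0 < M ->
  (forall r : R, 0 < r -> exists x xs, [/\ `|x - y| < r, A x xs & dual_le xs M]) ->
  dom A y.
Proof.
move=> maxA M0 Ay; have [x0 [xs0 [_ Ax0 _]]] := Ay 1 ltr01.
pose Q x (q : R) := M * `|x - y| <= q.
have [||||||u [k [uP uQ]]] := @sandwich _ _ (fitz_slice A y) Q x0
    (dp (x0 - y) xs0) 1 (M * (`|x0 - y| + 1)).
- exact: fitz_slice_convex.
- move=> x a x' b t /andP[t0 t1]; rewrite /Q => xa xb.
  have : `|t *: x + (1 - t) *: x' - y| <= t * `|x - y| + (1 - t) * `|x' - y|.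
    apply: norm_le_dp => f f1; have := f1 (x - y); have := f1 (x' - y).
    by rewrite !dpE !mul1r; nra.
  by nra.
- move=> x a b [xs [d [fx da]]]; rewrite /Q => Mb.
  have [N N0 xsN] := dual_bounded xs.
  rewrite leNgt; apply/negP => ab.
  pose r := - (a + b) / (2 * (N + M)).
  have NM : 0 < 2 * (N + M) by lra.
  have r0 : 0 < r by rewrite divr_gt0 //; lra.
  have rE : 2 * (N + M) * r = - (a + b) by rewrite /r; field; rewrite gt_eqF //; lra.
  have [v [vs [vy Av vsM]]] := Ay r r0.
  have h1 := fx _ _ Av; have h2 := xsN (y - v); have h3 := vsM (v - x).
  have h4 : `|v - x| <= `|v - y| + `|x - y|.
    by rewrite (distrC x); exact: ler_distD.
  have h5 : M * `|v - x| <= M * (r + `|x - y|) by rewrite ler_pM2l //; lra.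
  have h6 : N * `|y - v| <= N * r by rewrite ler_pM2l // distrC ltW.
  by move: h1 h2 h3; rewrite !dpE; lra.
- exact: ltr01.
- exact: fitz_slice_gra.
- move=> x xx0; rewrite /Q ler_pM2l //.
  by have := ler_distD x0 x y; lra.
exists u; apply: fitz_slice_support uP _ => //.
by have := uQ y 0; rewrite /Q subrr normr0 mulr0 => /(_ (lexx _)); lra.
Qed.

Definition bounded_near0 A (r M : R) := [/\ 0 < r, 0 < M,
  forall y, `|y| < r -> dom A y &
  forall y ys, `|y| < r -> A y ys -> dual_le ys M].

(** A point [w] of the interior is a convex combination of a point near [0], where
    [A] is bounded, and of a point of [fitz_dom A].  Hence the function whose
    epigraph is [fitz_slice A w] is bounded above near [w]; it is nonnegative at
    [w], and a subgradient at [w] belongs to [A w]. *)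
Lemma interior_fitz_dom A r M : maximally_monotone A -> bounded_near0 A r M ->
  interior (closure (fitz_dom A)) `<=` dom A.
Proof.
move=> maxA [r0 M0 rA rM] w /interior_ballP[e e0 eD].
have w1 : 0 < `|w| + 1 by rewrite ltr_wpDl.
pose t := e / (`|w| + 1).
have t0 : 0 < t by rewrite divr_gt0.
have tE : t * (`|w| + 1) = e by rewrite /t; field; rewrite gt_eqF.
(* v is close to a point slightly beyond w on the ray from 0 *)
have /closure_ballP/(_ (t * r / 2)) : closure (fitz_dom A) ((1 + t) *: w).
  apply: eD; rewrite scalerDl scale1r addrAC subrr add0r normrZ gtr0_norm //.
  lra.
move=> [|v [vs [c fv]] vw]; first by rewrite divr_gt0 // mulr_gt0.
pose l := t / (1 + t).
have t1 : 0 < 1 + t by lra.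
have l0 : 0 < l by rewrite divr_gt0.
have l1 : l < 1 by rewrite ltr_pdivrMr //; lra.
pose Q := fitz_slice A w.
pose P x (a : R) := x = w /\ 0 <= a.
have Qw y : `|y - w| < l * (r / 2) ->
    Q y (l * (M * (r + `|w|)) + (1 - l) * (c - dp w vs)).
  move=> yw; pose y1 := l^-1 *: (y - (1 - l) *: v).
  have y1E : y = l *: y1 + (1 - l) *: v.
    by rewrite scalerA divff ?gt_eqF // scale1r subrK.
  have y1r : `|y1| < r.
    have -> : y1 = l^-1 *: (y - w) - t^-1 *: (v - (1 + t) *: w).
      apply: dp_eq => f; rewrite !dpE /l; field.
      by rewrite !gt_eqF.
    apply: (le_lt_trans (ler_normB _ _)).
    rewrite !normrZ !gtr0_norm ?invr_gt0 //.
    have : l^-1 * `|y - w| < r / 2 by rewrite mulrC ltr_pdivrMr // mulrC.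
    have : t^-1 * `|v - (1 + t) *: w| < r / 2.
      by rewrite mulrC ltr_pdivrMr // mulrC mulrA.
    lra.
  have [y1s Ay1] := rA _ y1r.
  exists (l *: y1s + (1 - l) *: vs), (l * dp y1 y1s + (1 - l) * c); split.
    rewrite [X in fitz _ X]y1E; apply: fitz_convex; first by rewrite !ltW.
      by apply: fitz_gra => //; have [] := (maximally_monotoneP A).1 maxA.
    by [].
  have h1 : dp (y1 - w) y1s <= M * (r + `|w|).
    apply: (le_trans (rM _ _ y1r Ay1 _)); rewrite ler_pM2l //.
    by apply: (le_trans (ler_normB _ _)); lra.
  have : l * dp (y1 - w) y1s <= l * (M * (r + `|w|)) by rewrite ler_pM2l.
  by rewrite !dpE; lra.
have [||||||u [k [uP uQ]]] := @sandwich _ _ P Q w 0 (l * (r / 2))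
    (l * (M * (r + `|w|)) + (1 - l) * (c - dp w vs)).
- move=> x a y b s /andP[s0 s1] [-> a0] [-> b0]; split; last by nra.
  by rewrite -scalerDl addrC subrK scale1r.
- exact: fitz_slice_convex.
- by move=> x a b [-> a0] /(fitz_slice_ge maxA); lra.
- by rewrite mulr_gt0 // divr_gt0.
- by [].
- exact: Qw.
exists (- u); apply: (@fitz_slice_support _ _ _ (- k) maxA).
  by move=> x b /uQ; rewrite !dpE.
by have := uP w 0 (conj erefl (lexx _)); rewrite !dpE; lra.
Qed.

End Fitzpatrick.

(** * Convex sets and normal cones *)

Lemma convex_comb_lt (R : realType) (t a b r : R) :
  0 <= t -> t <= 1 -> a < r -> b < r -> t * a + (1 - t) * b < r.
Proof.
by move=> t0 t1 ar br; have [ab|ab] := leP a b;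
  [apply: le_lt_trans br|apply: le_lt_trans ar]; nra.
Qed.

Section ConvexSets.
Context (R : realType) (X : normedModType R).
Implicit Types (C : set X).

Lemma convex_setE C : convex_set C <-> convexS C.
Proof.
split=> [cC x y t /andP[t0 t1] Cx Cy|cC x y l].
  by have := cC x y (Itv01 t0 t1); rewrite !inE; apply.
rewrite !inE => Cx Cy; apply: cC => //.
by rewrite ge0 le1.
Qed.

Lemma closure_convex C : convexS C -> convexS (closure C).
Proof.
move=> cC x y t t01 /closure_ballP Cx /closure_ballP Cy.
apply/closure_ballP => r r0.
have [x' Cx' xx'] := Cx r r0; have [y' Cy' yy'] := Cy r r0.
exists (t *: x' + (1 - t) *: y'); first exact: cC.
have -> : t *: x' + (1 - t) *: y' - (t *: x + (1 - t) *: y) =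
    t *: (x' - x) + (1 - t) *: (y' - y).
  by apply: dp_eq => f; rewrite !dpE; ring.
move: t01 => /andP[t0 t1]; apply: (le_lt_trans (ler_normD _ _)).
by rewrite !normrZ !ger0_norm //; [exact: convex_comb_lt|lra].
Qed.

Lemma normal_coneE C x (xs : dual X) :
  normal_cone C x xs <-> C x /\ forall c, C c -> dp (c - x) xs <= 0.
Proof.
split=> -[Cx Cxs]; (split; first by []); first move=> c Cc.
  by rewrite -lee_fin; apply: le_trans Cxs; apply: ereal_sup_ubound; exists c.
by apply: ge_ereal_sup => _ [c Cc <-]; rewrite lee_fin; exact: Cxs.
Qed.

End ConvexSets.

(** * Graph points in thin tubes *)

Section Tube.
Context (R : realType) (X : normedModType R).
Implicit Types (A : operator X).

Definition normal_cone_sum_maximal := forall (A : operator X) (C : set X),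
  maximally_monotone A -> C !=set0 -> closed C -> convex_set C ->
  dom A `&` interior C !=set0 -> maximally_monotone (opadd A (normal_cone C)).

Hypothesis ncsum : normal_cone_sum_maximal.

(** Let [C] be the closed tube of radius [d / 2] around the segment from [a] to [x].
    If all graph points of [A] over [C] satisfied the opposite strict inequality,
    [(x, xs)] would be monotonically related to [A + N_C], hence [x] would be in
    [dom A], and a graph point over [x] itself contradicts strictness. *)
Lemma tube_graph_point A a x (xs : dual X) (d : R) :
  maximally_monotone A -> dom A a -> 0 < d ->
  exists (l : R) y ys, [/\ 0 <= l <= 1, `|y - (l *: x + (1 - l) *: a)| <= d,
    A y ys & dp (x - y) (xs - ys) <= 0].
Proof.
move=> maxA domA d0.
pose E : set X := [set y | exists l : R, 0 <= l <= 1 /\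
  `|y - (l *: x + (1 - l) *: a)| < d / 2].
have d2 : 0 < d / 2 by rewrite divr_gt0.
have cE : convexS E.
  move=> y y' t /andP[t0 t1] [l [/andP[l0 l1] yl]] [l' [/andP[l'0 l'1] yl']].
  exists (t * l + (1 - t) * l'); split.
    by apply/andP; split; nra.
  have -> : t *: y + (1 - t) *: y' - ((t * l + (1 - t) * l') *: x +
      (1 - (t * l + (1 - t) * l')) *: a) =
      t *: (y - (l *: x + (1 - l) *: a)) +
      (1 - t) *: (y' - (l' *: x + (1 - l') *: a)).
    by apply: dp_eq => f; rewrite !dpE; ring.
  apply: (le_lt_trans (ler_normD _ _)).
  by rewrite !normrZ !ger0_norm //; [exact: convex_comb_lt|lra].
have Ea : interior (closure E) a.
  apply/interior_ballP; exists (d / 2) => // y ya; apply: subset_closure.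
  by exists 0; split; [rewrite lexx ler01|rewrite scale0r add0r subr0 scale1r].
have Ex : interior (closure E) x.
  apply/interior_ballP; exists (d / 2) => // y yx; apply: subset_closure.
  exists 1; split; first by rewrite lexx ler01.
  by rewrite subrr scale0r addr0 scale1r.
have := @ncsum A (closure E) maxA.
case.
- by exists a; exact: interior_subset.
- exact: closed_closure.
- by apply/convex_setE; exact: closure_convex.
- by exists a.
move=> /= mS maxS; apply: contrapT => noy.
have pos y ys : closure E y -> A y ys -> 0 < dp (x - y) (xs - ys).
  move=> Ey Ay; rewrite ltNge; apply/negP => h; apply: noy.
  move/closure_ballP : Ey => /(_ _ d2)[y' [l [l01 y'l]] y'y].
  exists l, y, ys; split=> //.
  have := ler_distD y' y (l *: x + (1 - l) *: a); rewrite distrC in y'y.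
  lra.
have /maximally_monotoneP[_ /(_ x xs)] := conj mS maxS.
have EX : closure E x by exact: interior_subset.
case=> [y ? [ys Ay [n /normal_coneE[Ey En] <-]]|xs1 Ax [n _ _]].
  by have := pos _ _ Ey Ay; have := En _ EX; rewrite !dpE; lra.
by have := pos _ _ EX Ax; rewrite subrr dp0l ltxx.
Qed.

End Tube.

(** * Growth along the graph *)

Section BoundedNearZero.
Context (R : realType) (X : normedModType R).
Context (B : operator X) (r M : R).
Hypotheses (maxB : maximally_monotone B) (B0 : B 0 0)
  (Bnear : bounded_near0 B r M).
Implicit Types (x y z : X) (b : dual X).

(** Monotonicity against the points of a ball around [0], where [B] is bounded:
    the size of [b] is controlled by the single number [<x, b>]. *)
Lemma graph_dual_le x b : B x b ->
  dual_le b (2 * (dp x b + M * (`|x| + r)) / r).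
Proof.
move=> Bx; have [r0 M0 rB rM] := Bnear.
have [mB _] := (maximally_monotoneP B).1 maxB.
have small d : `|d| < r -> dp d b <= dp x b + M * (`|x| + r).
  move=> dr; have [ds Bd] := rB _ dr.
  have h1 := mB _ _ Bx _ _ Bd; have h2 := dual_leN (rM _ _ dr Bd) (x - d).
  have : M * `|x - d| <= M * (`|x| + r).
    by rewrite ler_pM2l //; apply: (le_trans (ler_normB _ _)); lra.
  by move: h1 h2; rewrite !dpE; lra.
move=> v; have [->|v0] := eqVneq v 0; first by rewrite dp0l normr0 mulr0.
have nv : 0 < `|v| by rewrite normr_gt0.
have s0 : 0 < r / (2 * `|v|) by rewrite divr_gt0 // mulr_gt0.
have /small : `|(r / (2 * `|v|)) *: v| < r.
  rewrite normrZ gtr0_norm //.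
  have -> : r / (2 * `|v|) * `|v| = r / 2 by field; rewrite gt_eqF.
  lra.
rewrite dpZl mulrC -ler_pdivlMr // => /le_trans; apply.
by rewrite le_eqVlt; apply/orP; left; apply/eqP; field; rewrite !gt_eqF.
Qed.

Lemma graph_dp_ge0 x b : B x b -> 0 <= dp x b.
Proof.
move=> Bx; have [mB _] := (maximally_monotoneP B).1 maxB.
by have := mB _ _ Bx _ _ B0; rewrite !dpE; lra.
Qed.

(** Otherwise [graph_dual_le] would bound the values of [B] along a sequence of
    points tending to [y], and [dom_of_bounded] would put [y] in [dom B]. *)
Lemma dp_blowup y T : ~ dom B y ->
  exists2 d : R, 0 < d & forall x b, `|x - y| < d -> B x b -> T < dp x b.
Proof.
move=> yB; have [r0 M0 _ _] := Bnear.
apply: contrapT => nd; apply: yB.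
pose K := 2 * (Num.max T 0 + M * (`|y| + 1 + r)) / r.
have mT : 0 <= Num.max T 0 by rewrite le_max lexx orbT.
have Ky : 0 < M * (`|y| + 1 + r) by have := normr_ge0 y; nra.
apply: (@dom_of_bounded _ _ _ _ K maxB).
  by rewrite divr_gt0 // mulr_gt0 //; lra.
move=> d d0; apply: contrapT => nx; apply: nd.
exists (Num.min d 1); first by rewrite lt_min d0 ltr01.
move=> x b; rewrite lt_min => /andP[xd x1] Bx; rewrite ltNge; apply/negP => xT.
apply: nx; exists x, b; split=> // v.
apply: (le_trans (graph_dual_le Bx v)); apply: ler_wpM2r => //.
rewrite /K ler_pM2r ?invr_gt0 // ler_pM2l //; apply: lerD.
  by rewrite le_max xT.
rewrite ler_pM2l //; have := lerB_dist x y.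
lra.
Qed.

(** For [x] exactly on the segment, [l (z - x) = (1 - l) x], so that
    [l <z - x, b> = (1 - l) <x, b>]; the error due to the distance to the segment
    is absorbed with [graph_dual_le].  If [<x, b>] is not large, then [b] is
    bounded and so is [<z - x, b>]. *)
Lemma dp_radial_ge z (k : R) : 0 < k -> exists2 C : R, 0 <= C &
  forall x b (l : R), 0 <= l -> l <= 1 - k -> `|x - l *: z| <= k * r / 4 ->
  B x b -> k / 2 * dp x b - C <= dp (z - x) b.
Proof.
move=> k0; have [r0 M0 _ _] := Bnear.
pose C1 := M * (`|z| + 2 * r).
have C10 : 0 < C1 by have := normr_ge0 z; rewrite /C1; nra.
pose M2 := 4 * C1 / (k * r).
have M20 : 0 < M2 by apply: divr_gt0; apply: mulr_gt0.
exists (C1 + M2 * (2 * `|z| + r)).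
  by have := normr_ge0 z; nra.
move=> x b l l0 lk xl Bx.
have k1 : k <= 1 by lra.
have kr : k * r <= r by nra.
have xE : `|x| <= `|z| + r.
  have := ler_distD 0 x (l *: z).
  have : `|x| <= `|x - l *: z| + `|l *: z| by rewrite -{1}(subrK (l *: z) x) ler_normD.
  by rewrite normrZ ger0_norm //; have := normr_ge0 z; nra.
have x0 := graph_dp_ge0 Bx.
pose Q := dp x b + M * (`|x| + r).
have bQ : dual_le b (2 * Q / r) by exact: graph_dual_le.
have QC : Q <= dp x b + C1.
  by rewrite lerD2l ler_pM2l //; lra.
have Qge : dp x b <= Q by rewrite lerDl mulr_ge0 //; [exact: ltW|apply: addr_ge0 => //; exact: ltW].
have Q0 : 0 <= Q by lra.
have h : k / 2 * Q - C1 <= l * dp (z - x) b.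
  have h1 := bQ (x - l *: z).
  have h2 : 2 * Q / r * `|x - l *: z| <= 2 * Q / r * (k * r / 4).
    by apply: ler_wpM2l => //; apply: divr_ge0; [exact: mulr_ge0|exact: ltW].
  have h3 : 2 * Q / r * (k * r / 4) = k / 2 * Q by field; rewrite gt_eqF.
  have h4 : k * (Q - C1) <= (1 - l) * dp x b by nra.
  by move: h1; rewrite !dpE; nra.
have C2 : 0 <= M2 * (2 * `|z| + r) by have := normr_ge0 z; nra.
have [QC1|QC1] := leP (k / 2 * Q) C1; last first.
  have l1 : l <= 1 by lra.
  have zx : 0 < l * dp (z - x) b by lra.
  have : l * dp (z - x) b <= dp (z - x) b by nra.
  by nra.
have bM2 : dual_le b M2.
  move=> v; apply: (le_trans (bQ v)); apply: ler_wpM2r => //.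
  rewrite /M2 ler_pdivlMr ?mulr_gt0 //.
  have -> : 2 * Q / r * (k * r) = 2 * k * Q by field; rewrite gt_eqF.
  lra.
have h1 := dual_leN bM2 (z - x).
have h2 : M2 * `|z - x| <= M2 * (2 * `|z| + r).
  by rewrite ler_pM2l //; apply: (le_trans (ler_normB _ _)); lra.
by nra.
Qed.

End BoundedNearZero.

(** * The gap inequality *)

Section GapBound.
Context (R : realType) (X : completeNormedModType R).
Context (A B : operator X) (r M : R).
Hypotheses (ncsum : normal_cone_sum_maximal X).
Hypotheses (maxA : maximally_monotone A) (maxB : maximally_monotone B).
Hypotheses (A0 : A 0 0) (B0 : B 0 0) (Bnear : bounded_near0 B r M).
Let D := closure (fitz_dom B).
Hypothesis AD : dom A `<=` D.
Implicit Types (x y z : X).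

Definition gap_ge z (zs : dual X) (g : R) :=
  forall x a b, A x a -> B x b -> g <= dp (z - x) (zs - a - b).

Let r0 : 0 < r. Proof. by have [] := Bnear. Qed.

Let D_convex : convexS D.
Proof. by apply: closure_convex; exact: fitz_dom_convex. Qed.

Let D_dom : interior D `<=` dom B.
Proof. exact: interior_fitz_dom maxB Bnear. Qed.

Let dom_D : dom B `<=` D.
Proof. by move=> x /(dom_fitz_dom maxB); exact: subset_closure. Qed.

Let D_ball x : `|x| < r -> D x.
Proof. by have [_ _ rB _] := Bnear => /rB /dom_D. Qed.

Let domA0 : dom A 0. Proof. by exists 0. Qed.

(** Near [z] the operator [B] is bounded, and a short tube around a segment
    ending at [z] supplies [y] close to [z] with [<z - y, - ys> <= 0]. *)
Lemma gap_le0_interior z zs g :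
  closure (dom A) z -> interior D z -> gap_ge z zs g -> g <= 0.
Proof.
move=> cAz Dz gap; rewrite leNgt; apply/negP => g0.
have [mB _] := (maximally_monotoneP B).1 maxB.
have Bz : interior (dom B) z.
  apply: (interiorS D_dom); move: (open_interior D).
  by rewrite openE; apply.
have [rz [Mz [rz0 Mz0 zB]]] := locally_bounded mB Bz.
have [e e0 eB] := (interior_ballP _ _).1 Bz.
have [N N0 zsN] := dual_bounded zs.
pose d := Num.min (Num.min e rz) (g / (N + Mz)) / 4.
have NM : 0 < N + Mz by lra.
have d0 : 0 < d by rewrite divr_gt0 // !lt_min e0 rz0 divr_gt0.
have d4 : d * 4 = Num.min (Num.min e rz) (g / (N + Mz)) by rewrite divfK.
have de : d * 4 <= e by rewrite d4 !ge_min lexx.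
have drz : d * 4 <= rz by rewrite d4 !ge_min lexx orbT.
have dg : (N + Mz) * (d * 4) <= g.
  by rewrite d4 mulrC -ler_pdivlMr // ge_min lexx orbT.
have [a Aa az] := (closure_ballP _ _).1 cAz d d0.
have [l [y [ys [/andP[l0 l1] yl Ay yz]]]] :=
  tube_graph_point ncsum z 0 maxA Aa d0.
have yz2 : `|y - z| <= 2 * d.
  have -> : y - z = (y - (l *: z + (1 - l) *: a)) + (1 - l) *: (a - z).
    by apply: dp_eq => f; rewrite !dpE; ring.
  apply: (le_trans (ler_normD _ _)); rewrite norm_scale_ge0; last lra.
  by have := normr_ge0 (a - z); nra.
have [b Bb] : dom B y by apply: eB; lra.
have bM : dual_le b Mz by apply: zB Bb; lra.
have h1 := gap _ _ _ Ay Bb; have h2 := zsN (z - y).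
have h3 := dual_leN bM (z - y); rewrite distrC in yz2.
have h4 : (N + Mz) * `|z - y| <= (N + Mz) * (2 * d) by rewrite ler_pM2l.
by move: yz h1 h2 h3; rewrite !dpE; nra.
Qed.

(** The point [w] is [y] moved into [int D], by an amount proportional to [e] both
    in the direction of [0] and in that of [z].  Since
    [e c (z - x) = (w - x) + (1 - e) (x - y) + (e - e c) x], a lower bound of
    [<z - x, xs>] follows from three others: the tube from [0] to [w] controls
    [<w - x, xs>], and monotonicity against [(y, ys)] and [(0, 0)] controls the
    other terms. *)
Lemma inward_graph_point z y ys (c N e q : R) :
  0 < c -> 2 * c <= 1 -> 2 * c * `|z| <= r -> A y ys -> 0 < N ->
  dual_le ys N -> 0 < e -> e <= 1 -> 0 < q ->
  exists (t : R) x xs, let w := (1 - e) *: y + (e * c) *: z in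
    [/\ 0 <= t <= 1, `|x - t *: w| <= q /\ `|x - t *: w| <= e * r / 4,
        A x xs, dom B x &
        (1 - t) * `|w| - e * c - N * (e * (`|z| + `|y|)) <=
          e * c * dp (z - x) xs].
Proof.
move=> c0 c1 cz Ay N0 ysN e0 e1 q0.
have [mA _] := (maximally_monotoneP A).1 maxA.
have Dy : D y by apply: AD; exists ys.
pose s := e * c; rewrite -/s.
have s0 : 0 < s by rewrite mulr_gt0.
have se : s <= e by rewrite /s; nra.
pose w := (1 - e) *: y + s *: z.
have z0 := normr_ge0 z; have y0 := normr_ge0 y.
(* the slope K beats the size of ys by one unit *)
pose K := N + 1; have K0 : 0 < K by rewrite addr_gt0.
have KN : 0 < K + N by rewrite addr_gt0.
pose d := Num.min (Num.min (e * r / 4) q) (s / (K + N)).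
have d0 : 0 < d.
  rewrite !lt_min q0 andbT; apply/andP; split; last exact: divr_gt0.
  by apply: divr_gt0 => //; exact: mulr_gt0.
have de : d <= e * r / 4 by rewrite !ge_min lexx.
have dq : d <= q by rewrite !ge_min lexx orbT.
have ds : (K + N) * d <= s by rewrite mulrC -ler_pdivlMr // ge_min lexx orbT.
have [f f1 fw] := norming_functional w.
have [t [x [xs [/andP[t0 t1] xw Ax wx]]]] :=
  tube_graph_point ncsum w (K *: f) maxA domA0 d0.
rewrite scaler0 addr0 in xw.
have Dw v : `|v - w| < e * r / 2 -> D v.
  move=> vw.
  have -> : v = (1 - e) *: y + (1 - (1 - e)) *: (c *: z + e^-1 *: (v - w)).
    apply: dp_eq => h; rewrite !dpE /w /s ?dpE; field.
    by rewrite gt_eqF.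
  apply: D_convex => //; first by apply/andP; split; lra.
  apply: D_ball; apply: (le_lt_trans (ler_normD _ _)).
  have ei0 : 0 <= e^-1 by rewrite invr_ge0 ltW.
  rewrite (norm_scale_ge0 _ (ltW c0)) (norm_scale_ge0 _ ei0).
  have : e^-1 * `|v - w| < r / 2 by rewrite mulrC ltr_pdivrMr // mulrC mulrA.
  lra.
have Dx : interior D x.
  apply/interior_ballP; exists (e * r / 4).
    by apply: divr_gt0 => //; exact: mulr_gt0.
  move=> v vx.
  have vt : `|v - t *: w| < e * r / 2 by have := ler_distD x v (t *: w); lra.
  have -> : v = t *: (w + (v - t *: w)) + (1 - t) *: (v - t *: w).
    by apply: dp_eq => h; rewrite !dpE; ring.
  apply: D_convex; first by rewrite t0.
    by apply: Dw; rewrite addrAC subrr add0r.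
  by apply: D_ball; nra.
exists t, x, xs; split.
- by rewrite t0.
- by split; [exact: le_trans dq|exact: le_trans de].
- by [].
- exact: D_dom.
clear Dx Dw de dq.
have hwx : K * ((1 - t) * `|w| - d) <= dp (w - x) xs.
  have h1 : (1 - t) * `|w| - d <= dp (w - x) f.
    by have := f1 (x - t *: w); rewrite mul1r -fw !dpE; lra.
  have h2 : K * ((1 - t) * `|w| - d) <= K * dp (w - x) f by rewrite ler_pM2l.
  by move: wx h2; rewrite !dpE; lra.
clear wx f1 fw f.
have tw0 : 0 <= (1 - t) * `|w| by rewrite mulr_ge0 // subr_ge0.
have ezy : 0 <= e * (`|z| + `|y|) by rewrite mulr_ge0 ?addr_ge0 // ltW.
pose U := N * (d + (1 - t) * `|w| + e * (`|z| + `|y|)).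
have hxy : - U <= dp (x - y) xs.
  have h1 := mA _ _ Ax _ _ Ay; have h2 := dual_leN ysN (x - y).
  have h3 : `|x - y| <= d + (1 - t) * `|w| + e * (`|z| + `|y|).
    have -> : x - y = (x - t *: w) - (1 - t) *: w + e *: (c *: z - y).
      by apply: dp_eq => h; rewrite !dpE /w /s ?dpE; ring.
    apply: (le_trans (ler_normD _ _)); apply: lerD.
      apply: (le_trans (ler_normB _ _)); apply: lerD => //.
      by rewrite norm_scale_ge0 // subr_ge0.
    rewrite (norm_scale_ge0 _ (ltW e0)) ler_pM2l //.
    apply: (le_trans (ler_normB _ _)); rewrite (norm_scale_ge0 _ (ltW c0)).
    by rewrite lerD2r ler_piMl //; lra.
  have : N * `|x - y| <= U by rewrite ler_pM2l.
  by move: h1 h2; rewrite !dpE; lra.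
have U0 : 0 <= U by apply: mulr_ge0; [exact: ltW|lra].
have hx0 : 0 <= dp x xs by have := mA _ _ Ax _ _ A0; rewrite !dpE; lra.
have -> : s * dp (z - x) xs = dp (w - x) xs + (1 - e) * dp (x - y) xs +
    (e - s) * dp x xs.
  by rewrite /w !dpE; ring.
have h1 : 0 <= (e - s) * dp x xs by rewrite mulr_ge0 // subr_ge0.
have h2 : - U <= (1 - e) * dp (x - y) xs.
  nra.
rewrite -/w; move: hwx h2 ds; rewrite /U /K; lra.
Qed.

(** The points [x] of [inward_graph_point] tend to [y] with [e], for if [t] stayed
    away from [1] the lower bound of [<z - x, xs>] would explode.  At a point [y]
    outside [dom B] the values [<x, b>] then exceed any bound.  By [dp_radial_ge] so
    does [<z - x, b>], whereas a lower bound on the gap forces [<x, b>] to stay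
    below the constant [2 G / k]. *)
Lemma gap_blowup z zs g y ys (k l : R) : 0 < k -> k <= 1 ->
  ~ dom B y -> A y ys -> 0 <= l -> l <= 1 - 2 * k ->
  `|y - l *: z| <= k * r / 8 -> ~ gap_ge z zs g.
Proof.
move=> k0 k1 nBy Ay l0 lk yl gap.
have [C C0 rad] := dp_radial_ge maxB B0 Bnear z k0.
have [N N0 ysN] := dual_bounded ys.
have [Nz Nz0 zsN] := dual_bounded zs.
have z0 := normr_ge0 z; have y0 := normr_ge0 y.
have zr : 0 < `|z| + r by rewrite ltr_wpDl.
(* c z stays in the ball of radius r / 2, which leaves room for the tube *)
pose c := r / (2 * (`|z| + r)).
have c0 : 0 < c by rewrite divr_gt0 // mulr_gt0.
have cE : 2 * c * (`|z| + r) = r by rewrite /c; field; rewrite gt_eqF.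
have c1 : 2 * c <= 1 by nra.
have cz : 2 * c * `|z| <= r by nra.
(* G collects all the constants that do not depend on the parameter e *)
pose G := Nz * (2 * `|z| + `|y| + r) + 1 + N * (`|z| + `|y|) / c + C + `|g|.
have G0 : 0 < G.
  have h1 : 0 <= Nz * (2 * `|z| + `|y| + r).
    by rewrite mulr_ge0 ?addr_ge0 ?mulr_ge0 // ltW.
  have h2 : 0 <= N * (`|z| + `|y|) / c.
    by apply: divr_ge0; [apply: mulr_ge0; [exact: ltW|exact: addr_ge0]|exact: ltW].
  by have := normr_ge0 g; rewrite /G; lra.
have [d d0 dB] := dp_blowup maxB Bnear (2 * G / k) nBy.
have S0 : 0 < r + G + `|z| + `|y| by lra.
pose e := Num.min k (d / (2 * (r + G + `|z| + `|y|))).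
have e0 : 0 < e by rewrite lt_min k0 divr_gt0 // mulr_gt0.
have ek : e <= k by rewrite ge_min lexx.
have eS : e * (2 * (r + G + `|z| + `|y|)) <= d.
  by rewrite -ler_pdivlMr ?mulr_gt0 // ge_min lexx orbT.
have kr0 : 0 < k * r / 8 by apply: divr_gt0 => //; exact: mulr_gt0.
have [t [x [xs /= [/andP[t0 t1] [xk xe] Ax [b Bb]]]]] :=
  inward_graph_point c0 c1 cz Ay N0 ysN e0 (le_trans ek k1) kr0.
move: xk xe; set s := e * c; set w := (1 - e) *: y + s *: z => xk xe hs.
have s0 : 0 < s by rewrite mulr_gt0.
have se : s <= e by rewrite /s; nra.
have wyz : `|w| <= `|y| + `|z|.
  have e1 : 0 <= 1 - e by lra.
  have s1 : s <= 1 by lra.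
  apply: (le_trans (ler_normD _ _)).
  rewrite (norm_scale_ge0 _ e1) (norm_scale_ge0 _ (ltW s0)).
  by nra.
have w0 := normr_ge0 w.
have xn : `|x| <= `|y| + `|z| + r.
  have : `|x| <= `|x - t *: w| + `|t *: w|.
    by rewrite -{1}(subrK (t *: w) x) ler_normD.
  have : e * r / 4 <= r by have := r0; nra.
  by rewrite norm_scale_ge0 //; nra.
have hb : k / 2 * dp x b - C <= dp (z - x) b.
  have el0 : 0 <= (1 - e) * l by apply: mulr_ge0 => //; lra.
  have el1 : (1 - e) * l + s <= 1 - k by nra.
  apply: (rad _ _ (t * ((1 - e) * l + s)) _ _ _ Bb).
  - by nra.
  - by nra.
  - have -> : x - (t * ((1 - e) * l + s)) *: z =
        (x - t *: w) + (t * (1 - e)) *: (y - l *: z).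
      by apply: dp_eq => h; rewrite !dpE /w /s ?dpE; ring.
    have te0 : 0 <= t * (1 - e) by apply: mulr_ge0 => //; lra.
    have te1 : t * (1 - e) <= 1 by nra.
    apply: (le_trans (ler_normD _ _)); rewrite (norm_scale_ge0 _ te0).
    have : t * (1 - e) * `|y - l *: z| <= `|y - l *: z| by rewrite ler_piMl.
    by lra.
have x0 := graph_dp_ge0 maxB B0 Bb.
have hg := gap _ _ _ Ax Bb.
have hz : dp (z - x) zs <= Nz * (2 * `|z| + `|y| + r).
  apply: (le_trans (zsN _)); rewrite ler_pM2l //.
  by apply: (le_trans (ler_normB _ _)); lra.
have tw0 : 0 <= (1 - t) * `|w| by rewrite mulr_ge0 // subr_ge0.
have main : (1 - t) * `|w| + s * (k / 2 * dp x b) <= s * G.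
  have h1 : s * (N * (`|z| + `|y|) / c) = N * (e * (`|z| + `|y|)).
    by rewrite /s; field; rewrite gt_eqF.
  have h2 : - g <= `|g| by rewrite -normrN ler_norm.
  have h3 : s * g <= s * (dp (z - x) zs - dp (z - x) xs - dp (z - x) b).
    by rewrite ler_pM2l //; move: hg; rewrite !dpE; lra.
  have h4 : s * dp (z - x) zs <= s * (Nz * (2 * `|z| + `|y| + r)).
    by rewrite ler_pM2l.
  have h5 : s * (k / 2 * dp x b - C) <= s * dp (z - x) b by rewrite ler_pM2l.
  have h6 : s * - g <= s * `|g| by rewrite ler_pM2l.
  by rewrite /G; lra.
have kx : 0 <= k / 2 * dp x b by rewrite mulr_ge0 // divr_ge0 // ltW.
have twG : (1 - t) * `|w| <= e * G.
  have : s * G <= e * G by rewrite ler_pM2r.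
  have : 0 <= s * (k / 2 * dp x b) by rewrite mulr_ge0 // ltW.
  by lra.
have : dp x b <= 2 * G / k.
  have : k / 2 * dp x b <= G.
    by rewrite -(ler_pM2l s0); lra.
  by rewrite ler_pdivlMr //; lra.
apply/negP; rewrite -ltNge; apply: dB Bb.
have -> : x - y = (x - t *: w) - (1 - t) *: w + e *: (c *: z - y).
  by apply: dp_eq => h; rewrite !dpE /w /s ?dpE; ring.
apply: (le_lt_trans (ler_normD _ _)).
have h1 : `|x - t *: w - (1 - t) *: w| <= e * r / 4 + e * G.
  apply: (le_trans (ler_normB _ _)); apply: lerD => //.
  by rewrite norm_scale_ge0 // subr_ge0.
have h2 : `|e *: (c *: z - y)| <= e * (`|z| + `|y|).
  rewrite (norm_scale_ge0 _ (ltW e0)) ler_pM2l //.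
  apply: (le_trans (ler_normB _ _)); rewrite (norm_scale_ge0 _ (ltW c0)).
  by rewrite lerD2r ler_piMl //; lra.
have : 0 < e * (r + G + `|z| + `|y|) by rewrite mulr_gt0.
have : 0 < e * r by rewrite mulr_gt0.
by lra.
Qed.

(** The tube from [0] to [z] meets [dom A] only at a distance from [z], where the
    norming functional of [z], multiplied by a large [K], makes [<z - y, ys>]
    large. *)
Lemma gap_le0_far z zs g : ~ closure (dom A) z -> gap_ge z zs g -> g <= 0.
Proof.
move=> ncl gap; rewrite leNgt; apply/negP => g0.
have [p p0 pA] : exists2 p : R, 0 < p & forall y, dom A y -> p <= `|y - z|.
  apply: contrapT => np; apply: ncl; apply/closure_ballP => q q0.
  apply: contrapT => ny; apply: np; exists q => // y Ay.
  by rewrite leNgt; apply/negP => yq; apply: ny; exists y.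
have zp : p <= `|z| by have := pA _ domA0; rewrite sub0r normrN.
have z0 : 0 < `|z| by lra.
pose k := p / (4 * `|z|).
have k0 : 0 < k by rewrite divr_gt0 // mulr_gt0.
have kE : 4 * k * `|z| = p by rewrite /k; field; rewrite gt_eqF.
have k1 : k <= 1 by nra.
have [C C0 rad] := dp_radial_ge maxB B0 Bnear z k0.
have [N N0 zsN] := dual_bounded zs.
have [f f1 fz] := norming_functional z.
pose d := Num.min (p / 4) (k * r / 8).
have d0 : 0 < d.
  by rewrite lt_min; apply/andP; split; apply: divr_gt0 => //; exact: mulr_gt0.
have dp' : d <= p / 4 by rewrite ge_min lexx.
have dk : d <= k * r / 8 by rewrite ge_min lexx orbT.
pose K := 4 * (N * (2 * `|z| + p) + C) / p.
have K0 : 0 <= K.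
  apply: divr_ge0; last exact: ltW.
  apply: mulr_ge0 => //; apply: addr_ge0 => //; apply: mulr_ge0; first exact: ltW.
  by have := normr_ge0 z; lra.
have [l [y [ys [/andP[l0 l1] yl Ay yz]]]] :=
  tube_graph_point ncsum z (K *: f) maxA domA0 d0.
rewrite scaler0 addr0 in yl.
have lz : p / 2 <= (1 - l) * `|z|.
  have := pA y (ex_intro _ _ Ay); have := ler_distD (l *: z) y z.
  have -> : `|l *: z - z| = (1 - l) * `|z|.
    rewrite -{2}[z]scale1r -scalerBl normrZ distrC ger0_norm //; lra.
  lra.
have lk : l <= 1 - 2 * k.
  have : 2 * k * `|z| <= (1 - l) * `|z| by lra.
  by rewrite ler_pM2r //; lra.
have [[b Bb]|nBy] := pselect (dom B y); last first.
  apply: (@gap_blowup z zs g y ys k l) => //; lra.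
have hb : k / 2 * dp y b - C <= dp (z - y) b.
  by apply: (rad _ _ l) => //; [lra|have := mulr_gt0 k0 r0; lra].
have y0 := graph_dp_ge0 maxB B0 Bb.
have hf : p / 4 <= dp (z - y) f.
  by have := f1 (y - l *: z); rewrite mul1r !dpE fz; lra.
have hK : K * (p / 4) <= K * dp (z - y) f by apply: ler_wpM2l.
have KE : K * (p / 4) = N * (2 * `|z| + p) + C by rewrite /K; field; rewrite gt_eqF.
have hg := gap _ _ _ Ay Bb.
have yn : `|z - y| <= 2 * `|z| + p.
  have := ler_distD (l *: z) z y; rewrite (distrC (l *: z) y).
  have -> : `|z - l *: z| = (1 - l) * `|z|.
    by rewrite -{1}[z]scale1r -scalerBl normrZ ger0_norm //; lra.
  by nra.
have hz : dp (z - y) zs <= N * (2 * `|z| + p).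
  by apply: (le_trans (zsN _)); rewrite ler_pM2l.
have kx : 0 <= k / 2 * dp y b by rewrite mulr_ge0 // divr_ge0 // ltW.
by move: yz hg hb hK hz; rewrite !dpE; lra.
Qed.

(** On the boundary of [D] the gap is transported to [l z], with [l < 1], which
    is interior to [D]; [(0, 0)] being in both graphs, little of it is lost. *)
Lemma gap_le0 z zs g : gap_ge z zs g -> g <= 0.
Proof.
move=> gap; have [cAz|] := pselect (closure (dom A) z);
  last by move=> h; exact: gap_le0_far h gap.
have [Dz|nDz] := pselect (interior D z); first exact: gap_le0_interior gap.
rewrite leNgt; apply/negP => g0.
have [mA _] := (maximally_monotoneP A).1 maxA.
have Dz : D z.
  suff : closure (dom A) `<=` D by apply.
  rewrite [X in _ `<=` X]((closure_id D).1 (@closed_closure _ _)).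
  exact: closureS AD.
pose e := g / (g + `|dp z zs|) / 2.
have gz : 0 < g + `|dp z zs| by rewrite ltr_wpDr.
have e0 : 0 < e by rewrite !divr_gt0.
have eE : 2 * e * (g + `|dp z zs|) = g by rewrite /e; field; rewrite gt_eqF.
have e1 : 2 * e <= 1 by have := normr_ge0 (dp z zs); nra.
pose l := 1 - e.
have Dlz : interior D (l *: z).
  apply/interior_ballP; exists (e * r); first exact: mulr_gt0.
  move=> v vz; have -> : v = l *: z + (1 - l) *: (e^-1 *: (v - l *: z)).
    by apply: dp_eq => h; rewrite !dpE /l; field; rewrite gt_eqF.
  apply: D_convex => //; first by rewrite /l; lra.
  apply: D_ball; rewrite normrZ gtr0_norm ?invr_gt0 //.
  by rewrite mulrC ltr_pdivrMr // mulrC.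
have gapl : gap_ge (l *: z) (l *: zs) (l * g - l * e * dp z zs).
  move=> x a b Aa Bb; have h := gap _ _ _ Aa Bb.
  have h1 : 0 <= dp x a by have := mA _ _ Aa _ _ A0; rewrite !dpE; lra.
  have h2 := graph_dp_ge0 maxB B0 Bb.
  have l0 : 0 < l by rewrite /l; lra.
  have h3 : l * g <= l * dp (z - x) (zs - a - b) by rewrite ler_pM2l.
  have h4 : 0 <= e * (dp x a + dp x b) by rewrite mulr_ge0 ?addr_ge0 // ltW.
  have -> : dp (l *: z - x) (l *: zs - a - b) = l * dp (z - x) (zs - a - b) -
      l * e * dp z zs + e * (dp x a + dp x b).
    by rewrite !dpE /l; ring.
  lra.
have : l * g - l * e * dp z zs <= 0.
  have [cl|] := pselect (closure (dom A) (l *: z));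
    last by move=> h; exact: gap_le0_far h gapl.
  exact: gap_le0_interior gapl.
have := ler_norm (dp z zs); have := normr_ge0 (dp z zs).
by rewrite -mulrA -mulrBr pmulr_rle0 /l; [nra|lra].
Qed.

End GapBound.

(** * From the gap inequality to maximality *)

Section SumTheorem.
Context (R : realType) (X : normedModType R).
Implicit Types (A B : operator X) (x y z : X) (xs ys zs : dual X).

Lemma opaddP A B x a b : A x a -> B x b -> opadd A B x (a + b).
Proof. by move=> Aa Bb; exists a => //; exists b. Qed.

Lemma opadd_related A B : (forall x xs, A x xs -> related A x xs) ->
  (forall x xs, B x xs -> related B x xs) ->
  forall x xs, opadd A B x xs -> related (opadd A B) x xs.
Proof.
move=> mA mB x _ [a Aa [b Bb <-]] y _ [a' Aa' [b' Bb' <-]].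
by have := mA _ _ Aa _ _ Aa'; have := mB _ _ Bb _ _ Bb'; rewrite !dpE; lra.
Qed.

(** [B] absorbs the normals to [C], because points of [dom B] only see them with
    the favourable sign. *)
Lemma opadd_normal_cone B C x b n : maximally_monotone B -> dom B `<=` C ->
  B x b -> normal_cone C x n -> B x (b + n).
Proof.
move=> /maximally_monotoneP[mB maxB] BC Bx /normal_coneE[Cx Cn].
apply: maxB => y ys By; have Cy : C y by apply: BC; exists ys.
by have := mB _ _ Bx _ _ By; have := Cn _ Cy; rewrite !dpE; lra.
Qed.

(** The reduction of maximality to the inequality [F_(A+B) >= <., .>]; see the
    discussion at the top. *)
Lemma opadd_maximal A B a0 r M :
  maximally_monotone A -> maximally_monotone B ->
  A 0 a0 -> bounded_near0 B r M ->
  (forall x xs c, fitz (opadd A B) x xs c -> dp x xs <= c) ->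
  maximally_monotone (opadd A B).
Proof.
move=> maxA maxB A0 Bnear fitzAB; have [r0 M0 rB rM] := Bnear.
have [mA mA'] := (maximally_monotoneP A).1 maxA.
have [mB mB'] := (maximally_monotoneP B).1 maxB.
apply/maximally_monotoneP; split; first exact: opadd_related.
move=> z zs rel.
have fz : fitz (opadd A B) z zs (dp z zs).
  by move=> y ys ABy; have := rel _ _ ABy; rewrite !dpE; lra.
(* F_(A+B) - <., .> attains its minimum 0 at (z, zs): derive along a segment *)
have tangent w ws c : fitz (opadd A B) w ws c ->
    dp z ws + dp w zs - dp z zs <= c.
  move=> fw; rewrite leNgt; apply/negP => cw.
  pose q := dp (w - z) (ws - zs); pose h := dp z ws + dp w zs - dp z zs - c.
  have h0 : 0 < h by rewrite subr_gt0.
  pose t := h / (2 * (h + `|q|)).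
  have hq : 0 < h + `|q| by rewrite ltr_wpDr.
  have t0 : 0 < t by rewrite divr_gt0 // mulr_gt0.
  have tE : 2 * t * (h + `|q|) = h by rewrite /t; field; rewrite gt_eqF.
  have t1 : 2 * t <= 1 by have := normr_ge0 q; nra.
  have t01 : 0 <= t <= 1 by apply/andP; split; lra.
  have := fitzAB _ _ _ (fitz_convex t01 fw fz).
  have -> : dp (t *: w + (1 - t) *: z) (t *: ws + (1 - t) *: zs) =
      dp z zs + t * (c + h - dp z zs) + t ^+ 2 * q.
    by rewrite /h /q !dpE; ring.
  have := ler_norm (- q); rewrite normrN => nq tt.
  have : t * (h + t * q) <= 0 by lra.
  rewrite pmulr_rle0 //; have := normr_ge0 q; nra.
pose Q x b := fitz_slice B z x (b + dp x zs - dp z zs).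
have [N N0 zsN] := dual_bounded zs.
have Qball y : `|y| < r -> Q y ((M + N) * (r + `|z|)).
  move=> yr; have [ys By] := rB _ yr.
  have [ys' [d [fy dy]]] := fitz_slice_gra z maxB By.
  exists ys', d; split=> //; apply: (le_trans dy).
  have zy : `|z - y| <= r + `|z| by apply: (le_trans (ler_normB _ _)); lra.
  have h1 := zsN (z - y); have h2 := dual_leN (rM _ _ yr By) (z - y).
  have h3 : M * `|z - y| <= M * (r + `|z|) by rewrite ler_pM2l.
  have h4 : N * `|z - y| <= N * (r + `|z|) by rewrite ler_pM2l.
  by move: h1 h2; rewrite !dpE; lra.
have [||||||u [k [uP uQ]]] := @sandwich _ _ (fitz_slice A z) Q 0
    (dp (0 - z) a0) r ((M + N) * (r + `|z|)).
- exact: fitz_slice_convex.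
- move=> x b x' b' t t01 Qx Qx'; rewrite /Q.
  have -> : t * b + (1 - t) * b' + dp (t *: x + (1 - t) *: x') zs - dp z zs =
      t * (b + dp x zs - dp z zs) + (1 - t) * (b' + dp x' zs - dp z zs).
    by rewrite !dpE; ring.
  exact: fitz_slice_convex.
- move=> x a b [xs [d [fx dx]]] [ys [d' [fy dy]]].
  have fxy : fitz (opadd A B) x (xs + ys) (d + d').
    move=> v _ [v1 Av [v2 Bv <-]]; have := fx _ _ Av; have := fy _ _ Bv.
    by rewrite !dpE; lra.
  by have := tangent _ _ _ fxy; rewrite !dpE; lra.
- by [].
- exact: fitz_slice_gra.
- by move=> y; rewrite subr0; exact: Qball.
have uB x c : fitz_slice B z x c ->
    dp x (zs - u) + (- k - dp z zs) <= c.
  move=> Bx; have := uQ x (c - dp x zs + dp z zs).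
  rewrite /Q !dpE => h; suff : - dp x u - k <= c - dp x zs + dp z zs by lra.
  apply: h; have -> // : c - dp x zs + dp z zs + dp x zs - dp z zs = c by ring.
have Bu : dp z u + k <= 0 -> B z (zs - u).
  by move=> h; apply: fitz_slice_support uB _ => //; rewrite !dpE; lra.
have Au : 0 <= dp z u + k -> A z u by exact: fitz_slice_support uP.
have k0 : dp z u + k = 0.
  have [h|h|//] := ltgtP (dp z u + k) 0.
    have /(fitz_slice_gra z maxB)/uB := Bu (ltW h).
    by rewrite !dpE; lra.
  have /(fitz_slice_gra z maxA)/uP := Au (ltW h).
  by rewrite !dpE; lra.
rewrite -(subrK u zs) addrC.
by apply: opaddP; [apply: Au|apply: Bu]; rewrite k0.
Qed.

End SumTheorem.

(** * The two implications *)

Section Equivalence.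
Context (R : realType) (X : completeNormedModType R).
Implicit Types (A B : operator X).

(** [A + N_D] replaces [A], where [D] is the closure of [fitz_dom B]. *)
Lemma opadd_maximal_at0 A B : normal_cone_sum_maximal X ->
  maximally_monotone A -> maximally_monotone B -> A 0 0 -> B 0 0 ->
  interior (dom B) 0 -> maximally_monotone (opadd A B).
Proof.
move=> ncsum maxA maxB A0 B0 domB.
have [mB _] := (maximally_monotoneP B).1 maxB.
have [mA _] := (maximally_monotoneP A).1 maxA.
have [r1 [M [r10 M0 rM]]] := locally_bounded mB domB.
have [r2 r20 rB] := (interior_ballP _ _).1 domB.
have Bnear : bounded_near0 B (Num.min r1 r2) M.
  split=> // [|y|y ys]; first by rewrite lt_min r10.
    by rewrite lt_min => /andP[_ yr]; apply: rB; rewrite subr0.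
  by rewrite lt_min => /andP[yr _]; apply: rM; rewrite subr0.
apply: (opadd_maximal maxA maxB A0 Bnear) => z zs c fz.
pose D := closure (fitz_dom B).
have BD : dom B `<=` D.
  by move=> x /(dom_fitz_dom maxB); exact: subset_closure.
have D0 : interior D 0 by exact: interiorS domB.
pose A' := opadd A (normal_cone D).
have maxA' : maximally_monotone A'.
  apply: ncsum => //.
  - by exists 0; exact: interior_subset.
  - exact: closed_closure.
  - by apply/convex_setE; apply: closure_convex; exact: fitz_dom_convex.
  - by exists 0; split=> //; exists 0.
have A'0 : A' 0 0.
  suff h : normal_cone D 0 0 by have := opaddP A0 h; rewrite addr0.
  by apply/normal_coneE; split=> [|d _]; [exact: interior_subset|rewrite dp0r].
have A'D : dom A' `<=` D by move=> x [_ [a _ [n /normal_coneE[Dx _] _]]].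
suff : dp z zs - c <= 0 by lra.
apply: (gap_le0 ncsum maxA' maxB A'0 B0 Bnear A'D (z := z) (zs := zs)).
move=> x _ b [a Aa [n Dn <-]] Bb.
have Bbn := opadd_normal_cone maxB BD Bb Dn.
by have := fz _ _ (opaddP Aa Bbn); rewrite !dpE; lra.
Qed.

Lemma opadd_maximal_of_normal_cone A B : normal_cone_sum_maximal X ->
  maximally_monotone A -> maximally_monotone B ->
  dom A `&` interior (dom B) !=set0 -> maximally_monotone (opadd A B).
Proof.
move=> ncsum maxA maxB [x [[a Aa] domB]].
have [b Bb] := interior_subset domB.
apply/(@translate_maximally_monotone _ _ _ x (a + b)).
have -> : translate (opadd A B) x (a + b) = opadd (translate A x a) (translate B x b).
  apply/funext => y; apply/seteqP; split=> ys.
    move=> [a' Aa' [b' Bb' E]]; exists (a' - a); first by rewrite /translate /= subrK.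
    exists (b' - b); first by rewrite /translate /= subrK.
    by rewrite addrACA -opprD E addrK.
  move=> [a' Aa' [b' Bb' <-]]; exists (a' + a) => //; exists (b' + b) => //.
  by rewrite addrACA.
apply: opadd_maximal_at0 => //.
- exact/translate_maximally_monotone.
- exact/translate_maximally_monotone.
- by rewrite /translate /= !add0r.
- by rewrite /translate /= !add0r.
have [r r0 rB] := (interior_ballP _ _).1 domB.
apply/interior_ballP; exists r => // y; rewrite subr0 => yr.
have [|ys Bys] := rB (y + x); first by rewrite addrK.
by exists (ys - b); rewrite /translate /= subrK.
Qed.

(** A point [x] outside [C] is related to no functional: let [z] be the last point
    of [C] on the segment from an interior point [c0] to [x].  Separating [C] from
    the line through [c0] and [x] gives a normal at [z] that is positive at [x - z],
    and large multiples of it contradict monotonicity. *)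
Lemma normal_cone_maximal (C : set X) : closed C -> convexS C ->
  interior C !=set0 -> maximally_monotone (normal_cone C).
Proof.
move=> clC cC [c0 Cc0]; apply/maximally_monotoneP; split.
  move=> x xs /normal_coneE[Cx xn] y ys /normal_coneE[Cy yn].
  by have := xn _ Cy; have := yn _ Cx; rewrite !dpE; lra.
move=> x xs rel.
have [r r0 rC] := (interior_ballP _ _).1 Cc0.
have [Cx|nCx] := pselect (C x).
  apply/normal_coneE; split=> // c Cc.
  have : normal_cone C c 0 by apply/normal_coneE; split.
  by move=> /rel; rewrite !dpE; lra.
exfalso.
pose T : set R := [set t | 0 <= t <= 1 /\ C (c0 + t *: (x - c0))].
have C0 : C c0 by exact: interior_subset.
have T0 : T 0 by rewrite /T /= lexx ler01 scale0r addr0.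
have supT : has_sup T.
  by split; [exists 0|exists 1 => t [/andP[_ ->]]].
pose b := sup T; pose z := c0 + b *: (x - c0).
have b0 : 0 <= b by apply: ub_le_sup => //; case: supT.
have b1 : b <= 1 by apply: ge_sup => [|t [/andP[_ ->]]]; first by exists 0.
have nx : 0 < `|x - c0| + 1 by rewrite ltr_wpDl.
have Cz : C z.
  rewrite [C](closure_id C).1 //; apply/closure_ballP => e e0.
  have e1 : 0 < e / (`|x - c0| + 1) by rewrite divr_gt0.
  have eE : e / (`|x - c0| + 1) * (`|x - c0| + 1) = e by field; rewrite gt_eqF.
  have [t [t01 Ct] bt] := sup_adherent e1 supT.
  exists (c0 + t *: (x - c0)) => //.
  have tb : t <= b by apply: ub_le_sup => //; case: supT.
  rewrite /z opprD addrACA subrr add0r -scalerBl normrZ distrC ger0_norm; last lra.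
  by move: bt; rewrite -/b; have := normr_ge0 (x - c0); nra.
have Cline t : C (z + t *: (x - c0)) -> t <= 0.
  move=> Ct; rewrite leNgt; apply/negP => t0.
  have bt : b + t <= 1 \/ 1 < b + t by have [|] := leP (b + t) 1; [left|right].
  case: bt => bt.
    suff : b + t <= b by lra.
    apply: ub_le_sup; first by case: supT.
    split; first by apply/andP; split; lra.
    by rewrite scalerDl addrA.
  apply: nCx; have := cC _ _ (b + t)^-1 _ Ct C0.
  have -> : (b + t)^-1 *: (z + t *: (x - c0)) + (1 - (b + t)^-1) *: c0 = x.
    apply: dp_eq => f; rewrite /z !dpE; field.
    by rewrite gt_eqF //; lra.
  apply; apply/andP; split; first by rewrite invr_ge0; lra.
  by rewrite invf_le1; lra.
pose P y (a : R) := exists t : R, y = z + t *: (x - c0) /\ a = - t.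
pose Q y (a : R) := C y /\ 0 <= a.
have [||||||u [k [uP uQ]]] := @sandwich _ _ P Q c0 b r 0.
- move=> ? ? ? ? s _ [t [-> ->]] [t' [-> ->]].
  exists (s * t + (1 - s) * t'); split; last by ring.
  by apply: dp_eq => f; rewrite !dpE; ring.
- move=> y a y' a' s s01 [Cy a0] [Cy' a'0]; split; first exact: cC.
  by move: s01 => /andP[s0 s1]; nra.
- by move=> ? a a' [t [-> ->]] [/Cline]; lra.
- by [].
- exists (- b); split; last by rewrite opprK.
  by rewrite /z scaleNr addrK.
- by move=> y yr; split=> //; exact: rC.
have uC c : C c -> - dp c u - k <= 0 by move=> Cc; exact: uQ.
have uL t : dp (z + t *: (x - c0)) u + k <= - t by apply: uP; exists t.
have n_normal s : 0 <= s -> normal_cone C z (s *: - u).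
  move=> s0; apply/normal_coneE; split=> // c Cc.
  have := uC _ Cc; have := uL 0; rewrite scale0r addr0 oppr0 !dpE => h1 h2.
  by nra.
have b_lt1 : b < 1.
  rewrite lt_neqAle b1 andbT; apply/eqP => b1E; apply: nCx.
  by move: Cz; rewrite /z b1E scale1r addrC subrK.
have xz : dp (x - z) u < 0.
  have -> : dp (x - z) u = (1 - b) * dp (x - c0) u by rewrite /z !dpE; ring.
  rewrite pmulr_rlt0; last lra.
  by have := uL 1; have := uC _ Cz; rewrite !dpE; lra.
pose s := (`|dp (x - z) xs| + 1) / - dp (x - z) u.
have s0 : 0 <= s by rewrite divr_ge0 ?addr_ge0 // oppr_ge0 ltW.
have sE : s * - dp (x - z) u = `|dp (x - z) xs| + 1.
  by rewrite /s divfK // oppr_eq0 lt_eqF.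
have := rel _ _ (n_normal s s0); rewrite dpDr dpNr dpZr dpNr sE.
by have := ler_norm (dp (x - z) xs); lra.
Qed.

End Equivalence.

Unset Implicit Arguments.
Set Strict Implicit.
Set Printing Implicit Defensive.

Theorem mainTheorem3 (R : realType) (X : completeNormedModType R) :
  (forall A B : operator X,
     maximally_monotone A -> maximally_monotone B ->
     dom A `&` interior (dom B) !=set0 ->
     maximally_monotone (opadd A B))
  <->
  (forall (A : operator X) (C : set X),
     maximally_monotone A ->
     C !=set0 -> closed C -> convex_set C ->
     dom A `&` interior C !=set0 ->
     maximally_monotone (opadd A (normal_cone C))).
Proof.
split=> [sum A C maxA _ clC /convex_setE cC [x [Ax Cx]]|ncsum A B maxA maxB AB].
  apply: sum => //; first by apply: normal_cone_maximal => //; exists x.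
  exists x; split=> //; apply: interiorS Cx => y Cy.
  by exists 0; apply/normal_coneE; split=> // c _; rewrite dp0r.
exact: opadd_maximal_of_normal_cone.
Qed.
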